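(* Let $\gamma_1,\gamma_2,\nu_1,\nu_2,\lambda,\mu,\beta_1,\beta_2$ be smooth functions on a domain $\mathcal{D}\subset\mathbb{R}^2$ (coordinates $(u,v)$) such that $$\frac{\mu_u}{2\mu\gamma_2+\nu_1\beta_2-\lambda\beta_1}>0,\qquad \frac{\mu_v}{2\mu\gamma_1-\lambda\beta_2+\nu_2\beta_1}>0,$$ and, defining the positive functions $\sqrt{E}:=\frac{\mu_u}{2\mu\gamma_2+\nu_1\beta_2-\lambda\beta_1}$ and $\sqrt{G}:=\frac{\mu_v}{2\mu\gamma_1-\lambda\beta_2+\nu_2\beta_1}$, the following equalities hold on $\mathcal{D}$: $$-\gamma_1\sqrt{E}\sqrt{G}=(\sqrt{E})_v,\qquad -\gamma_2\sqrt{E}\sqrt{G}=(\sqrt{G})_u,$$ $$\nu_1\nu_2-(\lambda^2+\mu^2)=\tfrac{1}{\sqrt{E}}(\gamma_2)_u+\tfrac{1}{\sqrt{G}}(\gamma_1)_v-(\gamma_1^2+\gamma_2^2),$$ $$2\lambda\gamma_2+\mu\beta_1-(\nu_1-\nu_2)\gamma_1=\tfrac{1}{\sqrt{E}}\lambda_u-\tfrac{1}{\sqrt{G}}(\nu_1)_v,$$ $$2\lambda\gamma_1+\mu\beta_2+(\nu_1-\nu_2)\gamma_2=-\tfrac{1}{\sqrt{E}}(\nu_2)_u+\tfrac{1}{\sqrt{G}}\lambda_v,$$ $$\gamma_1\beta_1-\gamma_2\beta_2+(\nu_1-\nu_2)\mu=-\tfrac{1}{\sqrt{E}}(\beta_2)_u+\tfrac{1}{\sqrt{G}}(\beta_1)_v.$$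 Let $(u_0,v_0)\in\mathcal{D}$, let $p_0\in\mathbb{R}^4$, and let $x_0,y_0,b_0,l_0$ be an orthonormal frame at $p_0$. Then there exist a subdomain $\mathcal{D}_0\subset\mathcal{D}$ containing $(u_0,v_0)$ and a unique surface $M^2: z=z(u,v)$, $(u,v)\in\mathcal{D}_0$, with $z(u_0,v_0)=p_0$, such that $\gamma_1,\gamma_2,\nu_1,\nu_2,\lambda,\mu,\beta_1,\beta_2$ are the geometric functions of $M^2$ and $x_0,y_0,b_0,l_0$ is the geometric frame of $M^2$ at $p_0$; that is, $\langle z_u,z_u\rangle=E$, $\langle z_u,z_v\rangle=0$, $\langle z_v,z_v\rangle=G$, and there is an orthonormal frame field $\{x,y,b,l\}$ along $M^2$ with $x=z_u/\sqrt{E}$, $y=z_v/\sqrt{G}$, $b,l$ normal to $M^2$, $(x,y,b,l)(u_0,v_0)=(x_0,y_0,b_0,l_0)$, satisfying $$\begin{aligned} &\nabla'_xx=\gamma_1y+\nu_1b, && \nabla'_xb=-\nu_1x-\lambda y+\beta_1l,\\ &\nabla'_xy=-\gamma_1x+\lambda b+\mu l, && \nabla'_yb=-\lambda x-\nu_2y+\beta_2l,\\ &\nabla'_yx=-\gamma_2y+\lambda b+\mu l, && \nabla'_xl=-\mu y-\beta_1b,\\ &\nabla'_yy=\gamma_2x+\nu_2b, && \nabla'_yl=-\mu x-\beta_2b. \end{aligned}$$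
   Context: $\nabla'$ denotes the flat Levi-Civita connection (directional derivative) of $\mathbb{R}^4$; for a vector function $w(u,v)$ along the surface, $\nabla'_xw=\frac{1}{\sqrt{E}}w_u$ and $\nabla'_yw=\frac{1}{\sqrt{G}}w_v$. Background (for orientation only): for a surface in $\mathbb{R}^4$ with $\varkappa^2-k>0$ parametrized by principal lines ($F=M=0$ in the paper's notation), the geometric frame $\{x,y,b,l\}$ consists of the unit tangent vectors $x=z_u/\sqrt{E}$, $y=z_v/\sqrt{G}$, a unit normal $b$ collinear with $\sigma(x,x)$ and $\sigma(y,y)$, and a unit normal $l$ completing a positively oriented orthonormal frame; the geometric functions are the coefficients $\gamma_1,\gamma_2,\nu_1,\nu_2,\lambda,\mu,\beta_1,\beta_2$ in the Frenet-type formulas displayed in the claim. *)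

(* Defs.v *)
From Stdlib Require Import Reals List.
From Coquelicot Require Import Coquelicot.
Open Scope R_scope.

Definition pu (f : R -> R -> R) : R -> R -> R :=
  fun u v => Derive (fun t => f t v) u.
Definition pv (f : R -> R -> R) : R -> R -> R :=
  fun u v => Derive (fun t => f u t) v.

Fixpoint iter_partial (l : list bool) (f : R -> R -> R) : R -> R -> R :=
  match l with
  | nil => f
  | b :: l' => (if b then pu else pv) (iter_partial l' f)
  end.

Definition as_set (D : R -> R -> Prop) : R * R -> Prop :=
  fun p => D (fst p) (snd p).

Definition smooth_on (D : R -> R -> Prop) (f : R -> R -> R) : Prop :=
  forall (l : list bool) (u v : R), D u v ->
    continuous (fun p : R * R => iter_partial l f (fst p) (snd p)) (u, v)
    /\ ex_derive (fun t => iter_partial l f t v) u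
    /\ ex_derive (fun t => iter_partial l f u t) v.

Definition connected_set (S : R * R -> Prop) : Prop :=
  forall A B : R * R -> Prop, open A -> open B ->
    (forall p, S p -> A p \/ B p) ->
    (forall p, S p -> A p -> B p -> False) ->
    (forall p, S p -> A p) \/ (forall p, S p -> B p).

Definition plane_domain (D : R -> R -> Prop) : Prop :=
  (exists u v, D u v) /\ open (as_set D) /\ connected_set (as_set D).

Record V4 := mkV4 { c0 : R; c1 : R; c2 : R; c3 : R }.

Definition vadd (a b : V4) : V4 :=
  mkV4 (c0 a + c0 b) (c1 a + c1 b) (c2 a + c2 b) (c3 a + c3 b).
Definition vscal (k : R) (a : V4) : V4 :=
  mkV4 (k * c0 a) (k * c1 a) (k * c2 a) (k * c3 a).
Definition vdot (a b : V4) : R :=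
  c0 a * c0 b + c1 a * c1 b + c2 a * c2 b + c3 a * c3 b.

Definition orthonormal4 (x y b l : V4) : Prop :=
  vdot x x = 1 /\ vdot y y = 1 /\ vdot b b = 1 /\ vdot l l = 1 /\
  vdot x y = 0 /\ vdot x b = 0 /\ vdot x l = 0 /\
  vdot y b = 0 /\ vdot y l = 0 /\ vdot b l = 0.

Definition pu4 (w : R -> R -> V4) : R -> R -> V4 :=
  fun u v => mkV4 (pu (fun a c => c0 (w a c)) u v) (pu (fun a c => c1 (w a c)) u v)
                  (pu (fun a c => c2 (w a c)) u v) (pu (fun a c => c3 (w a c)) u v).
Definition pv4 (w : R -> R -> V4) : R -> R -> V4 :=
  fun u v => mkV4 (pv (fun a c => c0 (w a c)) u v) (pv (fun a c => c1 (w a c)) u v)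
                  (pv (fun a c => c2 (w a c)) u v) (pv (fun a c => c3 (w a c)) u v).

Definition smooth4_on (D : R -> R -> Prop) (w : R -> R -> V4) : Prop :=
  smooth_on D (fun a c => c0 (w a c)) /\ smooth_on D (fun a c => c1 (w a c)) /\
  smooth_on D (fun a c => c2 (w a c)) /\ smooth_on D (fun a c => c3 (w a c)).

Definition sqrtE (g1 g2 n1 n2 la mu be1 be2 : R -> R -> R) (u v : R) : R :=
  pu mu u v / (2 * mu u v * g2 u v + n1 u v * be2 u v - la u v * be1 u v).
Definition sqrtG (g1 g2 n1 n2 la mu be1 be2 : R -> R -> R) (u v : R) : R :=
  pv mu u v / (2 * mu u v * g1 u v - la u v * be2 u v + n2 u v * be1 u v).

Definition is_geometric_surface (g1 g2 n1 n2 la mu be1 be2 : R -> R -> R)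
  (D0 : R -> R -> Prop) (z : R -> R -> V4)
  (u0 v0 : R) (p0 x0 y0 b0 l0 : V4) : Prop :=
  let sE := sqrtE g1 g2 n1 n2 la mu be1 be2 in
  let sG := sqrtG g1 g2 n1 n2 la mu be1 be2 in
  smooth4_on D0 z /\ z u0 v0 = p0 /\
  (forall u v, D0 u v ->
     vdot (pu4 z u v) (pu4 z u v) = sE u v ^ 2 /\
     vdot (pu4 z u v) (pv4 z u v) = 0 /\
     vdot (pv4 z u v) (pv4 z u v) = sG u v ^ 2) /\
  exists x y b l : R -> R -> V4,
    smooth4_on D0 x /\ smooth4_on D0 y /\ smooth4_on D0 b /\ smooth4_on D0 l /\
    x u0 v0 = x0 /\ y u0 v0 = y0 /\ b u0 v0 = b0 /\ l u0 v0 = l0 /\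
    forall u v, D0 u v ->
      let Dx w := vscal (/ sE u v) (pu4 w u v) in
      let Dy w := vscal (/ sG u v) (pv4 w u v) in
      orthonormal4 (x u v) (y u v) (b u v) (l u v) /\
      x u v = vscal (/ sE u v) (pu4 z u v) /\
      y u v = vscal (/ sG u v) (pv4 z u v) /\
      vdot (b u v) (pu4 z u v) = 0 /\ vdot (b u v) (pv4 z u v) = 0 /\
      vdot (l u v) (pu4 z u v) = 0 /\ vdot (l u v) (pv4 z u v) = 0 /\
      Dx x = vadd (vscal (g1 u v) (y u v)) (vscal (n1 u v) (b u v)) /\
      Dx y = vadd (vscal (- g1 u v) (x u v))
               (vadd (vscal (la u v) (b u v)) (vscal (mu u v) (l u v))) /\
      Dy x = vadd (vscal (- g2 u v) (y u v))
               (vadd (vscal (la u v) (b u v)) (vscal (mu u v) (l u v))) /\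
      Dy y = vadd (vscal (g2 u v) (x u v)) (vscal (n2 u v) (b u v)) /\
      Dx b = vadd (vscal (- n1 u v) (x u v))
               (vadd (vscal (- la u v) (y u v)) (vscal (be1 u v) (l u v))) /\
      Dy b = vadd (vscal (- la u v) (x u v))
               (vadd (vscal (- n2 u v) (y u v)) (vscal (be2 u v) (l u v))) /\
      Dx l = vadd (vscal (- mu u v) (y u v)) (vscal (- be1 u v) (b u v)) /\
      Dy l = vadd (vscal (- mu u v) (x u v)) (vscal (- be2 u v) (b u v)).

(* Main.v *)
Require Import Defs.
From Stdlib Require Import Reals List Lra ClassicalEpsilon.
From Coquelicot Require Import Coquelicot.
Open Scope R_scope.

(** The moving frame satisfies a linear system [w_u = M w], [w_v = N w] (position included, each
    coordinate of R^4 separately), and the hypotheses say exactly that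
    [M_v + M N = N_u + N M]; the two defining formulas for sqrt E and sqrt G are the equations
    for [mu_u] and [mu_v].  On a small square one first solves [w_u = M w] on the line
    [v = v0] and then [w_v = N w] on vertical lines.  To see that [w_u = M w] everywhere, put
    [H(u,v) = w(u,v) - w(u0,v) - int_{u0}^u M w]; compatibility gives
    [H_v = N H - int_{u0}^u N_u H] with [H(u,v0) = 0], and since the square is small each
    application of this equation halves the bound on [|H|], so [H = 0].

    Because the frame part of [M] and [N] is skew, [tr ((G - 1)^2)], with [G] the Gram matrix
    of the frame, and the squared distance between two solution frames are constant; this gives
    orthonormality and uniqueness. *)

(** * A contraction principle *)

(** The obstacle is regularity. The solution [W] of the integral equation is differentiable in [v]
    on the square, but in [u] only along [v = v0], so the two equations cannot be
    cross-differentiated. The defect of the [u]-equation is therefore measured through an integral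
    in [u], whose [v]-derivative does exist. One smallness condition, [4 * (r * (L * C)) <= 1] with
    [L] the number of unknowns and [C] a bound for [M], [N] and [N_u], serves twice. It makes the
    integral operator a contraction with factor 1/2, because two integrals over length at most [r]
    contribute, and it halves the bound on the defect, because two terms contribute to its
    [v]-derivative. By linearity [r] depends on the coefficients alone and not on the initial
    values. This is what lets the four coordinates be solved separately and still live on one common
    square. *)

Lemma half_pow_lt (B : R) (eps : posreal) :
  exists k, Rabs B * (1 / 2) ^ k < eps.
Proof.
destruct (pow_lt_1_zero (1 / 2) ltac:(rewrite Rabs_pos_eq; lra)
  (eps / (Rabs B + 1))) as [k Hk].
{ apply Rdiv_lt_0_compat; [apply eps | pose proof (Rabs_pos B); lra]. }
exists k. specialize (Hk k (le_n k)).
pose proof (Rabs_pos B) as HB.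
pose proof (pow_lt (1/2) k ltac:(lra)) as Hp.
rewrite Rabs_pos_eq in Hk by lra.
apply (Rmult_lt_compat_l (Rabs B + 1)) in Hk; [|lra].
replace ((Rabs B + 1) * (eps / (Rabs B + 1))) with (pos eps) in Hk by (field; lra).
nra.
Qed.

Lemma eq_0_of_le_half_pow (B x : R) :
  (forall k, Rabs x <= B * (1 / 2) ^ k) -> x = 0.
Proof.
intros H. destruct (Req_dec x 0) as [|Hx]; [assumption|exfalso].
destruct (half_pow_lt B (mkposreal _ (Rabs_pos_lt _ Hx))) as [k Hk]; simpl in Hk.
specialize (H k). pose proof (pow_lt (1/2) k ltac:(lra)).
pose proof (Rle_abs B). nra.
Qed.

(** Banach's iteration with the sup distance replaced by explicit bounds, so no function space is
    built. The members of the family may be unbounded; only [T W0 - W0] has to be bounded. Since [T]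
    contracts on continuous families only, the limit must be shown continuous before the fixed-point
    equation can be derived. *)
Lemma contraction_fixed_point {I : Type} {X : UniformSpace}
  (T : (I -> X -> R) -> I -> X -> R)
  (Tcont : forall W, (forall i x, continuous (W i) x) ->
     forall i x, continuous (T W i) x)
  (Tcontr : forall W W' B,
     (forall i x, continuous (W i) x) -> (forall i x, continuous (W' i) x) ->
     (forall i x, Rabs (W i x - W' i x) <= B) ->
     forall i x, Rabs (T W i x - T W' i x) <= B / 2)
  (W0 : I -> X -> R) (B0 : R) (HW0 : forall i x, continuous (W0 i) x)
  (HB0 : forall i x, Rabs (T W0 i x - W0 i x) <= B0) :
  exists W, (forall i x, continuous (W i) x) /\ (forall i x, T W i x = W i x) /\
    forall i x, Rabs (W i x - W0 i x) <= 2 * B0.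
Proof.
set (S := fun k => Nat.iter k T W0).
assert (Scont : forall k i x, continuous (S k i) x).
{ induction k as [|k IH]; [exact HW0 | exact (Tcont _ IH)]. }
assert (Hstep : forall k i x, Rabs (S (Datatypes.S k) i x - S k i x) <= B0 * (1/2) ^ k).
{ induction k as [|k IH]; intros i x.
  - simpl. rewrite Rmult_1_r. apply HB0.
  - eapply Rle_trans; [apply (Tcontr _ _ _ (Scont _) (Scont _) IH)|simpl; lra]. }
(* The geometric sum is kept exact, with its subtracted tail, so that the induction on [m]
   closes. *)
assert (Hdist : forall m k i x,
  Rabs (S (m + k)%nat i x - S k i x) <= 2 * B0 * (1/2) ^ k - 2 * B0 * (1/2) ^ (m + k)).
{ induction m as [|m IH]; intros k i x.
  - simpl. rewrite Rminus_diag, Rabs_R0. lra.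
  - specialize (IH k i x). specialize (Hstep (m + k)%nat i x).
    replace (S (Datatypes.S m + k)%nat i x - S k i x) with
      ((S (Datatypes.S (m + k)) i x - S (m + k)%nat i x) + (S (m + k)%nat i x - S k i x))
      by (simpl; ring).
    eapply Rle_trans; [apply Rabs_triang|]. simpl pow. lra. }
assert (Hd : forall k m i x, (k <= m)%nat ->
  Rabs (S m i x - S k i x) <= 2 * Rabs B0 * (1/2) ^ k).
{ intros k m i x Hkm. specialize (Hdist (m - k)%nat k i x).
  rewrite Nat.sub_add in Hdist by assumption.
  pose proof (pow_lt (1/2) k ltac:(lra)). pose proof (pow_lt (1/2) m ltac:(lra)).
  assert (0 <= B0).
  { specialize (Hstep 0%nat i x). simpl in Hstep.
    pose proof (Rabs_pos (T W0 i x - W0 i x)). lra. }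
  rewrite (Rabs_pos_eq B0) by assumption. nra. }
assert (Hlim : forall i x, ex_finite_lim_seq (fun k => S k i x)).
{ intros i x. apply ex_lim_seq_cauchy_corr. intros eps.
  destruct (half_pow_lt (4 * B0) eps) as [k Hk]. exists k.
  intros n m Hn Hm. pose proof (Hd k n i x Hn). pose proof (Hd k m i x Hm).
  replace (S n i x - S m i x) with ((S n i x - S k i x) - (S m i x - S k i x)) by ring.
  eapply Rle_lt_trans; [apply Rabs_triang|]. rewrite Rabs_Ropp.
  rewrite Rabs_mult, (Rabs_pos_eq 4) in Hk by lra. lra. }
set (W := fun i x => real (Lim_seq (fun k => S k i x))).
assert (HW : forall k i x, Rabs (W i x - S k i x) <= 2 * B0 * (1/2) ^ k).
{ intros k i x.
  assert (L : is_lim_seq (fun n => Rabs (S (n + k)%nat i x - S k i x))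
                (Rabs (W i x - S k i x))).
  { apply (is_lim_seq_abs _ (Finite _)).
    apply (is_lim_seq_minus' _ (fun _ => S k i x)); [|apply is_lim_seq_const].
    apply -> (is_lim_seq_incr_n (fun n => S n i x) k).
    destruct (Hlim i x) as [l Hl]. unfold W. rewrite (is_lim_seq_unique _ _ Hl). exact Hl. }
  apply (is_lim_seq_le _ (fun _ => 2 * B0 * (1/2) ^ k) _ _) with (2 := L)
    (3 := is_lim_seq_const _).
  intros n. specialize (Hdist n k i x). pose proof (pow_lt (1/2) (n + k) ltac:(lra)).
  assert (0 <= B0).
  { specialize (Hstep 0%nat i x). simpl in Hstep.
    pose proof (Rabs_pos (T W0 i x - W0 i x)). lra. }
  nra. }
(* Uniform limit argument: replacing [W] by the iterate [S k] at the two points costs at most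
   [4 * Rabs B0 * (1/2) ^ k], and what remains of [eps] is spent on the continuity of [S k]. *)
assert (Wcont : forall i x, continuous (W i) x).
{ intros i x. apply filterlim_locally. intros eps.
  destruct (half_pow_lt (6 * B0) eps) as [k Hk].
  rewrite Rabs_mult, (Rabs_pos_eq 6) in Hk by lra.
  assert (He : 0 < eps - 4 * Rabs B0 * (1/2) ^ k).
  { pose proof (pow_lt (1/2) k ltac:(lra)). pose proof (Rabs_pos B0).
    pose proof (Rmult_le_pos _ _ H0 (Rlt_le _ _ H)). lra. }
  pose proof (proj1 (filterlim_locally _ _) (Scont k i x) (mkposreal _ He)) as Hc.
  revert Hc. apply filter_imp. intros y Hy.
  change (Rabs (S k i y - S k i x) < eps - 4 * Rabs B0 * (1/2) ^ k) in Hy.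
  change (Rabs (W i y - W i x) < eps).
  replace (W i y - W i x) with
    ((W i y - S k i y) + (S k i y - S k i x) - (W i x - S k i x)) by ring.
  eapply Rle_lt_trans; [apply Rabs_triang|]. rewrite Rabs_Ropp.
  pose proof (Rabs_triang (W i y - S k i y) (S k i y - S k i x)).
  pose proof (HW k i y). pose proof (HW k i x).
  pose proof (pow_lt (1/2) k ltac:(lra)). pose proof (Rle_abs B0). nra. }
exists W. split; [exact Wcont|split].
(* Compare with the iterates: [T W - T (S k)] and [W - S (k + 1)] are both at most [B0 * (1/2) ^ k],
   for every [k]. *)
- intros i x. apply Rminus_diag_uniq.
  apply (eq_0_of_le_half_pow (2 * B0)). intros k.
  pose proof (Tcontr W (S k) _ Wcont (Scont k) (HW k) i x) as H1.
  pose proof (HW (Datatypes.S k) i x) as H2. simpl in H2.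
  change (T (Nat.iter k T W0)) with (T (S k)) in H2.
  replace (T W i x - W i x) with ((T W i x - T (S k) i x) - (W i x - T (S k) i x)) by ring.
  eapply Rle_trans; [apply Rabs_triang|]. rewrite Rabs_Ropp.
  change (S (Datatypes.S k)) with (T (S k)) in H2. lra.
- intros i x. pose proof (HW 0%nat i x) as H. simpl in H. lra.
Qed.

(** * Finite sums, continuity and integrals *)

(** A finite index type is represented by a list that exhausts it; the length of the list plays the
    part of the dimension in the estimates. *)
Definition isum {I : Type} (s : list I) (f : I -> R) : R :=
  fold_right (fun i a => f i + a) 0 s.

Lemma isum_ext {I} (s : list I) (f g : I -> R) :
  (forall i, f i = g i) -> isum s f = isum s g.
Proof. intros H. induction s; simpl; [|rewrite H, IHs]; reflexivity. Qed.

Lemma isum_minus {I} (s : list I) (f g : I -> R) :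
  isum s (fun i => f i - g i) = isum s f - isum s g.
Proof. induction s; simpl; lra. Qed.

Lemma isum_plus {I} (s : list I) (f g : I -> R) :
  isum s (fun i => f i + g i) = isum s f + isum s g.
Proof. induction s; simpl; lra. Qed.

Lemma isum_bound {I} (s : list I) (f : I -> R) (B : R) :
  (forall i, Rabs (f i) <= B) -> Rabs (isum s f) <= INR (length s) * B.
Proof.
intros H. induction s as [|a s IH].
- simpl. rewrite Rabs_R0. lra.
- change (Rabs (f a + isum s f) <= INR (S (length s)) * B). rewrite S_INR.
  eapply Rle_trans; [apply Rabs_triang|]. specialize (H a). lra.
Qed.

Lemma isum_mult_bound {I} (s : list I) (f g : I -> R) (C B : R) :
  (forall i, Rabs (f i) <= C) -> (forall i, Rabs (g i) <= B) ->
  Rabs (isum s (fun i => f i * g i)) <= INR (length s) * (C * B).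
Proof.
intros Hf Hg. apply isum_bound. intros i. rewrite Rabs_mult.
apply Rmult_le_compat; auto using Rabs_pos.
Qed.

Lemma isum_continuous {I} {U : UniformSpace} (s : list I) (f : I -> U -> R) (x : U) :
  (forall i, continuous (f i) x) -> continuous (fun y => isum s (fun i => f i y)) x.
Proof.
intros H. induction s as [|a s IH]; simpl.
- apply continuous_const.
- apply (continuous_plus (V := R_NormedModule) (f a)); auto.
Qed.

Lemma isum_mult_continuous {I} {U : UniformSpace} (s : list I) (f g : I -> U -> R) (x : U) :
  (forall i, continuous (f i) x) -> (forall i, continuous (g i) x) ->
  continuous (fun y => isum s (fun i => f i y * g i y)) x.
Proof.
intros Hf Hg. apply (isum_continuous s (fun i y => f i y * g i y)).
intros i. apply (continuous_mult (K := R_AbsRing)); auto.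
Qed.

Lemma isum_is_derive {I} (s : list I) (f : I -> R -> R) (df : I -> R) (x : R) :
  (forall i, is_derive (f i) x (df i)) ->
  is_derive (fun y => isum s (fun i => f i y)) x (isum s df).
Proof.
intros H. induction s as [|a s IH]; simpl.
- apply (is_derive_const (V := R_NormedModule)).
- apply (is_derive_plus (f a)); auto.
Qed.

Lemma finite_bound {I} (s : list I) (Hs : forall i, In i s) (f : I -> R) :
  exists B, 0 <= B /\ forall i, Rabs (f i) <= B.
Proof.
enough (H : exists B, 0 <= B /\ forall i, In i s -> Rabs (f i) <= B).
{ destruct H as [B [? H]]. exists B. split; auto. }
clear Hs. induction s as [|a s [B [HB H]]].
- exists 0. split; [lra | intros i []].
- exists (B + Rabs (f a)). pose proof (Rabs_pos (f a)). split; [lra|].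
  intros i [->|Hi]; [|specialize (H i Hi)]; lra.
Qed.

Lemma locally_finite_forall {I} {U : UniformSpace} (s : list I) (Hs : forall i, In i s)
  (x : U) (P : I -> U -> Prop) :
  (forall i, locally x (P i)) -> locally x (fun y => forall i, P i y).
Proof.
intros H.
enough (L : locally x (fun y => forall i, In i s -> P i y)).
{ revert L. apply filter_imp. auto. }
clear Hs. induction s as [|a s IH].
- apply filter_forall. intros y i [].
- generalize (filter_and _ _ (H a) IH). apply filter_imp.
  intros y [Ha Hy] i [<-|Hi]; auto.
Qed.

Lemma continuous_slice_l (f : R -> R -> R) (u v : R) :
  continuous (fun p : R * R => f (fst p) (snd p)) (u, v) -> continuous (fun s => f s v) u.
Proof.
intros H. apply (continuous_comp_2 (fun s => s) (fun _ => v) f).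
- apply continuous_id.
- apply continuous_const.
- exact H.
Qed.

Lemma continuous_slice_r (f : R -> R -> R) (u v : R) :
  continuous (fun p : R * R => f (fst p) (snd p)) (u, v) -> continuous (f u) v.
Proof.
intros H. apply (continuous_comp_2 (fun _ => u) (fun s => s) f).
- apply continuous_const.
- apply continuous_id.
- exact H.
Qed.

Lemma ex_RInt_continuous_everywhere (f : R -> R) (a b : R) :
  (forall t, continuous f t) -> ex_RInt f a b.
Proof. intros H. apply (ex_RInt_continuous (V := R_CompleteNormedModule)). auto. Qed.

(** Integrals start at the centre of the square and may run in either direction, hence the unordered
    endpoints. *)
Lemma RInt_bound (f : R -> R) (a b B : R) :
  ex_RInt f a b ->
  (forall t, Rmin a b <= t <= Rmax a b -> Rabs (f t) <= B) ->
  Rabs (RInt f a b) <= Rabs (b - a) * B.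
Proof.
intros Hf H. destruct (Rle_dec a b) as [Hab|Hab].
- rewrite (Rabs_pos_eq (b - a)) by lra. apply abs_RInt_le_const; auto.
  intros t Ht. apply H. rewrite Rmin_left, Rmax_right; lra.
- rewrite <- opp_RInt_swap by (apply ex_RInt_swap; exact Hf).
  change (opp (RInt f b a)) with (- RInt f b a).
  rewrite Rabs_Ropp, Rabs_minus_sym, (Rabs_pos_eq (a - b)) by lra.
  apply abs_RInt_le_const; [lra|apply ex_RInt_swap; exact Hf|].
  intros t Ht. apply H. rewrite Rmin_right, Rmax_left; lra.
Qed.

(** Split the integral at [v]. Over the fixed segment from [a] to [v], uniform continuity makes
    [g u' - g u] small; over the short segment from [v] to [v'], the integrand is bounded by [C],
    its size at [(u, v)] plus 1. *)
Lemma continuous_RInt_param (g : R -> R -> R) (a : R) :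
  (forall u v, continuous (fun p : R * R => g (fst p) (snd p)) (u, v)) ->
  forall u v, continuous (fun p : R * R => RInt (g (fst p)) a (snd p)) (u, v).
Proof.
intros Hg u v.
assert (Hint : forall w b c, ex_RInt (g w) b c).
{ intros w b c. apply ex_RInt_continuous_everywhere. intros t. apply continuous_slice_r, Hg. }
apply filterlim_locally. intros eps. 
assert (He1 : 0 < eps / 2 / (Rabs (v - a) + 1)).
{ apply Rdiv_lt_0_compat; [destruct eps; simpl; lra | pose proof (Rabs_pos (v - a)); lra]. }
destruct (uniform_continuity_2d_1d' g (Rmin a v) (Rmax a v) u) with (eps := mkposreal _ He1)
  as [d1 Hd1].
{ intros t _. apply continuity_2d_pt_filterlim. exact (Hg u t). }
assert (H2 := proj1 (filterlim_locally _ _) (Hg u v) (mkposreal 1 Rlt_0_1)).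
destruct H2 as [d2 Hd2].
set (C := Rabs (g u v) + 1).
assert (HC : 0 < C) by (unfold C; pose proof (Rabs_pos (g u v)); lra).
assert (He3 : 0 < eps / 2 / C) by (apply Rdiv_lt_0_compat; [destruct eps; simpl; lra | exact HC]).
assert (Hd : 0 < Rmin d1 (Rmin d2 (eps / 2 / C))).
{ repeat apply Rmin_glb_lt; auto; [apply d1|apply d2]. }
exists (mkposreal _ Hd). intros [u' v'] [Hu Hv]. simpl in Hu, Hv.
change (Rabs (u' - u) < Rmin d1 (Rmin d2 (eps / 2 / C))) in Hu.
change (Rabs (v' - v) < Rmin d1 (Rmin d2 (eps / 2 / C))) in Hv.
pose proof (Rmin_l d1 (Rmin d2 (eps / 2 / C))).
pose proof (Rmin_r d1 (Rmin d2 (eps / 2 / C))).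
pose proof (Rmin_l d2 (eps / 2 / C)). pose proof (Rmin_r d2 (eps / 2 / C)).
change (Rabs (RInt (g u') a v' - RInt (g u) a v) < eps).
rewrite <- (RInt_Chasles (g u') a v v') by apply Hint.
change (plus ?x ?y) with (x + y).
replace (RInt (g u') a v + RInt (g u') v v' - RInt (g u) a v) with
  ((RInt (g u') a v - RInt (g u) a v) + RInt (g u') v v') by ring.
rewrite <- (RInt_minus (V := R_CompleteNormedModule) (g u') (g u)) by apply Hint.
eapply Rle_lt_trans; [apply Rabs_triang|].
assert (B1 : Rabs (RInt (fun t => minus (g u' t) (g u t)) a v) <=
   Rabs (v - a) * (eps / 2 / (Rabs (v - a) + 1))).
{ apply RInt_bound; [apply (ex_RInt_minus (V := R_NormedModule)); apply Hint|].
  intros t Ht. apply Rlt_le. apply (Hd1 t u t u'); auto.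
  - destruct d1; simpl; lra.
  - apply Rabs_def2 in Hu. lra.
  - rewrite Rminus_diag, Rabs_R0. apply d1. }
assert (B2 : Rabs (RInt (g u') v v') <= Rabs (v' - v) * C).
{ apply RInt_bound; [apply Hint|]. intros t Ht.
  assert (Hb : Rabs (g u' t - g u v) < 1).
  { apply (Hd2 (u', t)). split.
    - change (Rabs (u' - u) < d2). lra.
    - change (Rabs (t - v) < d2).
      assert (Rabs (t - v) <= Rabs (v' - v)).
      { unfold Rabs. destruct (Rcase_abs (t - v)), (Rcase_abs (v' - v));
        unfold Rmin, Rmax in Ht; destruct (Rle_dec v v'); lra. }
      lra. }
  unfold C. pose proof (Rabs_triang (g u' t - g u v) (g u v)) as Htr.
  replace (g u' t - g u v + g u v) with (g u' t) in Htr by ring. lra. }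
assert (C1 : Rabs (v - a) * (eps / 2 / (Rabs (v - a) + 1)) < eps / 2).
{ pose proof (Rabs_pos (v - a)).
  replace (eps / 2) with ((Rabs (v - a) + 1) * (eps / 2 / (Rabs (v - a) + 1))) at 2
    by (field; lra).
  apply Rmult_lt_compat_r; lra. }
assert (C2 : Rabs (v' - v) * C <= eps / 2).
{ replace (eps / 2) with (eps / 2 / C * C) by (field; lra).
  apply Rmult_le_compat_r; lra. }
eapply Rle_lt_trans; [apply Rplus_le_compat; [exact B1 | exact B2]|]. lra.
Qed.

(* The nearest point of [[a - r, a + r]] to [t]; the formula makes continuity immediate. *)
Definition clamp (a r t : R) : R := a + (Rabs (t - a + r) - Rabs (t - a - r)) / 2.

Lemma clamp_continuous (a r t : R) : continuous (clamp a r) t.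
Proof.
unfold clamp.
apply (continuous_plus (V := R_NormedModule) (fun _ => a)
  (fun t => (Rabs (t - a + r) - Rabs (t - a - r)) / 2)); [apply continuous_const|].
apply (continuous_mult (K := R_AbsRing)
  (fun t => Rabs (t - a + r) - Rabs (t - a - r)) (fun _ => / 2)); [|apply continuous_const].
apply (continuous_minus (V := R_NormedModule)
  (fun t => Rabs (t - a + r)) (fun t => Rabs (t - a - r)));
apply continuous_Rabs_comp; apply (ex_derive_continuous (V := R_NormedModule));
auto_derive; exact I.
Qed.

Lemma clamp_bound (a r t : R) : 0 <= r -> Rabs (clamp a r t - a) <= r.
Proof. intros Hr. unfold clamp. split_Rabs; lra. Qed.

Lemma clamp_id (a r t : R) : Rabs (t - a) <= r -> clamp a r t = t.
Proof. unfold clamp. intros H. split_Rabs; lra. Qed.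

(** * Linear systems on a square *)

Lemma is_derive_RInt_continuous (f : R -> R) (a x : R) :
  (forall t, continuous f t) -> is_derive (fun y => RInt f a y) x (f x).
Proof.
intros H. apply (is_derive_RInt f (RInt f a) a x); [|apply H].
apply filter_forall. intros y.
apply (RInt_correct (V := R_CompleteNormedModule)), ex_RInt_continuous_everywhere, H.
Qed.

Lemma locally_Rabs_lt (a r t : R) : Rabs (t - a) < r -> locally t (fun s => Rabs (s - a) < r).
Proof.
intros H. assert (Hd : 0 < r - Rabs (t - a)) by lra.
exists (mkposreal _ Hd). intros s Hs.
change (Rabs (s - t) < r - Rabs (t - a)) in Hs.
replace (s - a) with ((s - t) + (t - a)) by ring.
eapply Rle_lt_trans; [apply Rabs_triang | lra].
Qed.

(* Both equations are encoded in the single integral equation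
   [W(u,v) = w0 + int_{u0}^u (m W)(s,v0) ds + int_{v0}^v (n W)(u,t) dt];
   clamping the endpoints makes the right-hand side a contraction on functions on the plane. *)
Lemma picard {I : Type} (s : list I) (Hs : forall i, In i s)
  (m n : I -> I -> R -> R -> R) (C r u0 v0 : R)
  (Hm : forall i j p, continuous (fun p : R * R => m i j (fst p) (snd p)) p)
  (Hn : forall i j p, continuous (fun p : R * R => n i j (fst p) (snd p)) p)
  (HmC : forall i j u v, Rabs (m i j u v) <= C)
  (HnC : forall i j u v, Rabs (n i j u v) <= C)
  (Hr : 0 < r) (HrC : 4 * (r * (INR (length s) * C)) <= 1)
  (w0 : I -> R) :
  exists (W : I -> R -> R -> R) (B : R),
    (forall i p, continuous (fun p : R * R => W i (fst p) (snd p)) p) /\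
    (forall i u v, Rabs (W i u v) <= B) /\
    (forall i, W i u0 v0 = w0 i) /\
    (forall i u, Rabs (u - u0) < r ->
       is_derive (fun x => W i x v0) u (isum s (fun j => m i j u v0 * W j u v0))) /\
    (forall i u v, Rabs (v - v0) < r ->
       is_derive (W i u) v (isum s (fun j => n i j u v * W j u v))).
Proof.
set (f := fun (W : I -> R * R -> R) i x => isum s (fun j => m i j x v0 * W j (x, v0))).
set (g := fun (W : I -> R * R -> R) i u t => isum s (fun j => n i j u t * W j (u, t))).
set (T := fun (W : I -> R * R -> R) i (p : R * R) =>
  w0 i + RInt (f W i) u0 (clamp u0 r (fst p)) + RInt (g W i (fst p)) v0 (clamp v0 r (snd p))).
assert (Hf : forall W, (forall i p, continuous (W i) p) -> forall i x, continuous (f W i) x).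
{ intros W HW i x. apply isum_mult_continuous; intros j.
  - apply (continuous_slice_l (m i j)). apply (Hm i j (x, v0)).
  - apply (continuous_slice_l (fun a b => W j (a, b))).
    apply (continuous_ext (W j)); [intros []; reflexivity | apply HW]. }
assert (Hg : forall W, (forall i p, continuous (W i) p) ->
  forall i u v, continuous (fun p : R * R => g W i (fst p) (snd p)) (u, v)).
{ intros W HW i u v.
  apply (isum_mult_continuous s (fun j p => n i j (fst p) (snd p))
    (fun j p => W j (fst p, snd p))); intros j; [apply Hn|].
  apply (continuous_ext (W j)); [intros []; reflexivity | apply HW]. }
assert (Hint : forall (h : R -> R) a b B, (forall t, continuous h t) ->
  0 <= r -> (forall t, Rabs (h t) <= B) -> Rabs (RInt h a (clamp a r b)) <= r * B).
{ intros h a b B Hh H0 HB.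
  eapply Rle_trans; [apply RInt_bound; [apply ex_RInt_continuous_everywhere, Hh|auto]|].
  apply Rmult_le_compat_r; [|apply clamp_bound, H0].
  eapply Rle_trans; [apply Rabs_pos | apply (HB 0)]. }
assert (Tcont : forall W, (forall i p, continuous (W i) p) ->
  forall i p, continuous (T W i) p).
{ intros W HW i [u v].
  apply (continuous_plus (V := R_NormedModule)
    (fun p : R * R => w0 i + RInt (f W i) u0 (clamp u0 r (fst p)))
    (fun p : R * R => RInt (g W i (fst p)) v0 (clamp v0 r (snd p)))).
  - apply (continuous_plus (V := R_NormedModule) (fun _ => w0 i)
      (fun p : R * R => RInt (f W i) u0 (clamp u0 r (fst p)))); [apply continuous_const|].
    apply (continuous_comp (fun p : R * R => clamp u0 r (fst p)) (RInt (f W i) u0)).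
    + apply (continuous_comp fst (clamp u0 r)); [apply continuous_fst|apply clamp_continuous].
    + apply (ex_derive_continuous (V := R_NormedModule)). eexists.
      apply is_derive_RInt_continuous, Hf, HW.
  - apply (continuous_comp_2 (fun p : R * R => fst p) (fun p : R * R => clamp v0 r (snd p))
      (fun a b => RInt (g W i a) v0 b)).
    + apply continuous_fst.
    + apply (continuous_comp snd (clamp v0 r)); [apply continuous_snd|apply clamp_continuous].
    + apply (continuous_RInt_param (g W i)). apply Hg, HW. }
destruct (finite_bound s Hs w0) as [b0 [Hb0 Hw0]].
assert (Tcontr : forall W W' B,
  (forall i p, continuous (W i) p) -> (forall i p, continuous (W' i) p) ->
  (forall i p, Rabs (W i p - W' i p) <= B) ->
  forall i p, Rabs (T W i p - T W' i p) <= B / 2).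
{ intros W W' B HW HW' HB i p.
  assert (HB0 : 0 <= B) by (eapply Rle_trans; [apply Rabs_pos | apply (HB i p)]).
  assert (HC0 : 0 <= C) by (eapply Rle_trans; [apply Rabs_pos | apply (HmC i i 0 0)]).
  assert (Ef : Rabs (RInt (f W i) u0 (clamp u0 r (fst p)) - RInt (f W' i) u0 (clamp u0 r (fst p)))
    <= r * (INR (length s) * (C * B))).
  { rewrite <- (RInt_minus (V := R_CompleteNormedModule) (f W i) (f W' i))
      by (apply ex_RInt_continuous_everywhere; apply Hf; assumption).
    apply Hint; [|lra|].
    - intros t. apply (continuous_minus (V := R_NormedModule)); apply Hf; assumption.
    - intros t. change (Rabs (f W i t - f W' i t) <= INR (length s) * (C * B)).
      unfold f. rewrite <- isum_minus.
      rewrite (isum_ext s _ (fun j => m i j t v0 * (W j (t, v0) - W' j (t, v0))))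
        by (intros; ring).
      apply isum_mult_bound; auto. }
  assert (Eg : Rabs (RInt (g W i (fst p)) v0 (clamp v0 r (snd p))
      - RInt (g W' i (fst p)) v0 (clamp v0 r (snd p))) <= r * (INR (length s) * (C * B))).
  { rewrite <- (RInt_minus (V := R_CompleteNormedModule) (g W i (fst p)) (g W' i (fst p)))
      by (apply ex_RInt_continuous_everywhere; intros t;
          apply (continuous_slice_r (g _ i)); apply Hg; assumption).
    apply Hint; [|lra|].
    - intros t. apply (continuous_minus (V := R_NormedModule));
        apply (continuous_slice_r (g _ i)); apply Hg; assumption.
    - intros t. change (Rabs (g W i (fst p) t - g W' i (fst p) t) <= INR (length s) * (C * B)).
      unfold g. rewrite <- isum_minus.
      rewrite (isum_ext s _ (fun j => n i j (fst p) t * (W j (fst p, t) - W' j (fst p, t))))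
        by (intros; ring).
      apply isum_mult_bound; auto. }
  unfold T.
  match goal with |- Rabs (?a + ?b + ?c - (?a + ?d + ?e)) <= _ =>
    replace (a + b + c - (a + d + e)) with ((b - d) + (c - e)) by ring end.
  eapply Rle_trans; [apply Rabs_triang|].
  eapply Rle_trans; [apply Rplus_le_compat; [exact Ef | exact Eg]|].
  replace (r * (INR (length s) * (C * B)) + r * (INR (length s) * (C * B)))
    with (B / 2 * (4 * (r * (INR (length s) * C)))) by field.
  rewrite <- (Rmult_1_r (B / 2)) at 2. apply Rmult_le_compat_l; lra. }
assert (T0 : forall i p, T (fun _ _ => 0) i p = w0 i).
{ intros i p. unfold T, f, g.
  rewrite (RInt_ext _ (fun _ => 0)), (RInt_ext (fun t => isum s _) (fun _ => 0)).
  - rewrite !RInt_const. change (scal ?x ?y) with (x * y). ring.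
  - intros t _. rewrite (isum_ext s _ (fun _ => 0 - 0)) by (intros; ring).
    rewrite (isum_minus s (fun _ => 0) (fun _ => 0)). lra.
  - intros t _. rewrite (isum_ext s _ (fun _ => 0 - 0)) by (intros; ring).
    rewrite (isum_minus s (fun _ => 0) (fun _ => 0)). lra. }
(* The constant family [w0] is the image of 0 under [T], so the contraction property turns the bound
   [b0] on [w0 - 0] into [b0 / 2] on [T w0 - w0]. It also yields the global bound [2 * b0] on the
   solution. *)
destruct (contraction_fixed_point T Tcont Tcontr (fun i _ => w0 i) (b0 / 2))
  as [W [HW [HTW HWB]]].
{ intros i p. apply continuous_const. }
{ intros i p. change (Rabs (T (fun i _ => w0 i) i p - w0 i) <= b0 / 2).
  replace (w0 i) with (T (fun _ _ => 0) i p) by apply T0. apply Tcontr.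
  - intros. apply continuous_const.
  - intros. apply continuous_const.
  - intros j q. rewrite Rminus_0_r. apply Hw0. }
exists (fun i u v => W i (u, v)), (2 * b0). split; [|split; [|split; [|split]]].
- intros i p. apply (continuous_ext (W i)); [intros []; reflexivity | apply HW].
- assert (Habs : forall x y b, Rabs (x - y) <= 2 * (b / 2) -> Rabs y <= b -> Rabs x <= 2 * b)
    by (intros; split_Rabs; lra).
  intros i u v. exact (Habs _ _ _ (HWB i (u, v)) (Hw0 i)).
- intros i. rewrite <- HTW. unfold T. simpl.
  rewrite !clamp_id by (rewrite Rminus_diag, Rabs_R0; lra).
  rewrite !RInt_point. change (@zero _) with 0. ring.
- intros i u Hu.
  apply (is_derive_ext_loc (fun x => w0 i + RInt (f W i) u0 x)).
  + generalize (locally_Rabs_lt _ _ _ Hu). apply filter_imp. intros x Hx.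
    rewrite <- HTW. unfold T. simpl.
    rewrite !clamp_id by (try rewrite Rminus_diag, Rabs_R0; lra).
    rewrite RInt_point. change (@zero _) with 0. ring.
  + rewrite <- (Rplus_0_l (isum _ _)). apply (is_derive_plus (fun _ => w0 i)).
    * apply (is_derive_const (V := R_NormedModule)).
    * apply (is_derive_RInt_continuous (f W i)), Hf, HW.
- intros i u v Hv.
  apply (is_derive_ext_loc (fun x =>
    w0 i + RInt (f W i) u0 (clamp u0 r u) + RInt (g W i u) v0 x)).
  + generalize (locally_Rabs_lt _ _ _ Hv). apply filter_imp. intros x Hx.
    rewrite <- HTW. unfold T. simpl. rewrite (clamp_id v0 r x) by lra. reflexivity.
  + rewrite <- (Rplus_0_l (isum _ _)).
    apply (is_derive_plus (fun _ => w0 i + RInt (f W i) u0 (clamp u0 r u))).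
    * apply (is_derive_const (V := R_NormedModule)).
    * apply (is_derive_RInt_continuous (g W i u)). intros t.
      apply (continuous_slice_r (g W i)), Hg, HW.
Qed.

Definition square (u0 v0 r u v : R) : Prop := Rabs (u - u0) < r /\ Rabs (v - v0) < r.

Lemma square_open (u0 v0 r : R) (p : R * R) :
  square u0 v0 r (fst p) (snd p) ->
  locally p (fun q => square u0 v0 r (fst q) (snd q)).
Proof.
destruct p as [u v]. intros [Hu Hv].
destruct (locally_Rabs_lt _ _ _ Hu) as [d1 H1], (locally_Rabs_lt _ _ _ Hv) as [d2 H2].
assert (Hd : 0 < Rmin d1 d2) by (apply Rmin_glb_lt; [apply d1 | apply d2]).
exists (mkposreal _ Hd). intros [u' v'] [Hu' Hv']. split.
- apply H1. eapply ball_le; [apply Rmin_l | exact Hu'].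
- apply H2. eapply ball_le; [apply Rmin_r | exact Hv'].
Qed.

Lemma Rabs_between (a b t r : R) : Rabs (b - a) < r -> Rmin a b <= t <= Rmax a b ->
  Rabs (t - a) < r.
Proof.
intros H Ht. unfold Rmin, Rmax in Ht. destruct (Rle_dec a b); split_Rabs; lra.
Qed.

Lemma continuous_swap (f : R -> R -> R) (u v : R) :
  continuous (fun p : R * R => f (fst p) (snd p)) (u, v) ->
  continuous (fun p : R * R => f (snd p) (fst p)) (v, u).
Proof.
intros H. apply (continuous_comp_2 (fun p : R * R => snd p) (fun p => fst p) f).
- apply continuous_snd.
- apply continuous_fst.
- exact H.
Qed.

Lemma is_derive_Rmult (f g : R -> R) (x df dg : R) :
  is_derive f x df -> is_derive g x dg ->
  is_derive (fun y => f y * g y) x (df * g x + f x * dg).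
Proof.
intros Hf Hg. apply (is_derive_mult f g); auto. intros; apply Rmult_comm.
Qed.

Lemma is_derive_Rminus (f g : R -> R) (x df dg : R) :
  is_derive f x df -> is_derive g x dg ->
  is_derive (fun y => f y - g y) x (df - dg).
Proof. intros Hf Hg. apply (is_derive_minus f g); auto. Qed.

(** * Propagation of the [u]-equation from the line [v = v0] to the square *)

Section Compatibility.

Context {I : Type} (s : list I) (M N : I -> I -> R -> R -> R) (u0 v0 r C B : R)
  (W : I -> R -> R -> R).
Let Q := square u0 v0 r.
Hypotheses (Hr : 0 < r <= 1) (HrC : 4 * (r * (INR (length s) * C)) <= 1)
  (HM : forall i j u v, Q u v -> continuous (fun p : R * R => M i j (fst p) (snd p)) (u, v))
  (HN : forall i j u v, Q u v -> continuous (fun p : R * R => N i j (fst p) (snd p)) (u, v))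
  (HMv : forall i j u v, Q u v -> ex_derive (M i j u) v)
  (HNu : forall i j u v, Q u v -> ex_derive (fun x => N i j x v) u)
  (HNuc : forall i j u v, Q u v ->
     continuous (fun p : R * R => pu (N i j) (fst p) (snd p)) (u, v))
  (HMC : forall i j u v, Q u v -> Rabs (M i j u v) <= C)
  (HNC : forall i j u v, Q u v -> Rabs (N i j u v) <= C)
  (HNuC : forall i j u v, Q u v -> Rabs (pu (N i j) u v) <= C)
  (Hflat : forall i (w : I -> R) u v, Q u v ->
     isum s (fun j => pv (M i j) u v * w j) +
     isum s (fun j => M i j u v * isum s (fun k => N j k u v * w k)) =
     isum s (fun j => pu (N i j) u v * w j) +
     isum s (fun j => N i j u v * isum s (fun k => M j k u v * w k)))
  (HW : forall i p, continuous (fun p : R * R => W i (fst p) (snd p)) p)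
  (HWB : forall i u v, Rabs (W i u v) <= B)
  (HWu : forall i u, Rabs (u - u0) < r ->
     is_derive (fun x => W i x v0) u (isum s (fun j => M i j u v0 * W j u v0)))
  (HWv : forall i u v, Q u v ->
     is_derive (W i u) v (isum s (fun j => N i j u v * W j u v))).

Let MW i u v := isum s (fun j => M i j u v * W j u v).
Let NW i u v := isum s (fun j => N i j u v * W j u v).
(** [K] has [u]-derivative [M W] by construction, so the [u]-equation for [W] amounts to [W = K]. *)
Let K i u v := W i u0 v + RInt (fun x => MW i x v) u0 u.

Let Q_between u v t : Q u v -> Rmin u0 u <= t <= Rmax u0 u -> Q t v.
Proof. intros [Hu Hv] Ht. split; [exact (Rabs_between _ _ _ _ Hu Ht) | exact Hv]. Qed.

Let Q_center v : Rabs (v - v0) < r -> Q u0 v.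
Proof. intros Hv. split; [rewrite Rminus_diag, Rabs_R0; lra | exact Hv]. Qed.

Let MW_continuous i u v : Q u v ->
  continuous (fun p : R * R => MW i (fst p) (snd p)) (u, v).
Proof.
intros Hq. apply (isum_mult_continuous s (fun j p => M i j (fst p) (snd p))
  (fun j p => W j (fst p) (snd p))); auto.
Qed.

Let W_slice i u v : continuous (fun x => W i x v) u.
Proof. apply (continuous_slice_l (W i)), HW. Qed.

Let MW_integrable i u v : Q u v -> ex_RInt (fun x => MW i x v) u0 u.
Proof.
intros Hq. apply (ex_RInt_continuous (V := R_CompleteNormedModule)). intros t Ht.
apply (continuous_slice_l (MW i)), MW_continuous, (Q_between _ _ _ Hq Ht).
Qed.

Let K_derive i u v : Q u v -> is_derive (fun x => K i x v) u (MW i u v).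
Proof.
intros Hq. rewrite <- (Rplus_0_l (MW i u v)).
apply (is_derive_plus (fun _ => W i u0 v)); [apply (is_derive_const (V := R_NormedModule))|].
apply (is_derive_RInt (fun x => MW i x v) (fun y => RInt (fun x => MW i x v) u0 y) u0 u).
- generalize (locally_Rabs_lt _ _ _ (proj1 Hq)). apply filter_imp. intros y Hy.
  apply (RInt_correct (V := R_CompleteNormedModule)), MW_integrable.
  split; [exact Hy | apply Hq].
- apply (continuous_slice_l (MW i)), MW_continuous, Hq.
Qed.

Let K_slice i u v : Q u v -> continuous (fun x => K i x v) u.
Proof.
intros Hq. apply (ex_derive_continuous (V := R_NormedModule)).
eexists. apply K_derive, Hq.
Qed.

(** The product rule and the [v]-equation give [M_v W + M N W]; compatibility exchanges this for
    [N_u W + N M W]. In that form it is jointly continuous, because [N_u] is, and [N M W] can be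
    integrated by parts in [u]. *)
Let MW_derive_v i u v : Q u v -> is_derive (MW i u) v
  (isum s (fun j => pu (N i j) u v * W j u v) + isum s (fun j => N i j u v * MW j u v)).
Proof.
intros Hq. unfold MW at 2. rewrite <- (Hflat i (fun j => W j u v)) by exact Hq.
rewrite <- isum_plus. apply (isum_is_derive s (fun j x => M i j u x * W j u x)). intros j.
apply is_derive_Rmult; [apply Derive_correct, HMv, Hq | apply HWv, Hq].
Qed.

Let dMW i u v :=
  isum s (fun j => pu (N i j) u v * W j u v) + isum s (fun j => N i j u v * MW j u v).

Let dMW_continuous i u v : Q u v ->
  continuous (fun p : R * R => dMW i (fst p) (snd p)) (u, v).
Proof.
intros Hq. apply (continuous_plus (V := R_NormedModule)
  (fun p : R * R => isum s (fun j => pu (N i j) (fst p) (snd p) * W j (fst p) (snd p)))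
  (fun p : R * R => isum s (fun j => N i j (fst p) (snd p) * MW j (fst p) (snd p)))).
- apply (isum_mult_continuous s (fun j p => pu (N i j) (fst p) (snd p))
  (fun j p => W j (fst p) (snd p))); auto.
- apply (isum_mult_continuous s (fun j p => N i j (fst p) (snd p))
  (fun j p => MW j (fst p) (snd p))); auto.
Qed.

Let RInt_MW_derive_v i u v : Q u v ->
  is_derive (fun y => RInt (fun x => MW i x y) u0 u) v (RInt (fun x => dMW i x v) u0 u).
Proof.
intros Hq.
rewrite (RInt_ext (fun x => dMW i x v) (fun x => Derive (fun y => MW i x y) v)).
- apply (is_derive_RInt_param (fun y x => MW i x y)).
  + generalize (locally_Rabs_lt _ _ _ (proj2 Hq)). apply filter_imp. intros y Hy t Ht.
    eexists. apply MW_derive_v. apply (Q_between u); [|exact Ht]. split; [apply Hq | exact Hy].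
  + intros t Ht. apply continuity_2d_pt_filterlim.
    (* Differentiation under the integral asks for joint continuity of [Derive]. It agrees with
       [dMW] only inside the square, so continuity is transferred on a neighbourhood; the parameter
       [v] comes first here, hence the swapped pair. *)
    refine (continuous_ext_loc (fun p : R * R => Derive (fun z => MW i (snd p) z) (fst p))
      (fun p : R * R => dMW i (snd p) (fst p)) (v, t) _ _).
    * generalize (locally_Rabs_lt _ _ _ (proj2 Hq)). intros [d Hd].
      destruct (locally_Rabs_lt _ _ _ (proj1 (Q_between _ _ _ Hq Ht))) as [e He].
      assert (Hde : 0 < Rmin d e) by (apply Rmin_glb_lt; [apply d | apply e]).
      exists (mkposreal _ Hde). intros [y x] [Hy Hx]. symmetry. apply is_derive_unique.
      apply MW_derive_v. split.
      -- apply He. eapply ball_le; [apply Rmin_r | exact Hx].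
      -- apply Hd. eapply ball_le; [apply Rmin_l | exact Hy].
    * apply (continuous_swap (dMW i)), dMW_continuous, (Q_between _ _ _ Hq Ht).
  + generalize (locally_Rabs_lt _ _ _ (proj2 Hq)). apply filter_imp. intros y Hy.
    apply MW_integrable. split; [apply Hq | exact Hy].
- intros t Ht. symmetry. apply is_derive_unique, MW_derive_v, (Q_between _ _ _ Hq). lra.
Qed.

Let H i u v := W i u v - K i u v.

Let NuH_integrable i u v : Q u v ->
  ex_RInt (fun x => isum s (fun j => pu (N i j) x v * H j x v)) u0 u.
Proof.
intros Hq. apply (ex_RInt_continuous (V := R_CompleteNormedModule)). intros t Ht.
pose proof (Q_between _ _ _ Hq Ht) as Hqt.
apply (isum_mult_continuous s (fun j x => pu (N i j) x v) (fun j x => H j x v)); intros j.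
- apply (continuous_slice_l (pu (N i j))), HNuc, Hqt.
- apply (continuous_minus (V := R_NormedModule)); auto.
Qed.

(* Integrating [d/ds (N K) = N_u K + N M W] from [u0] to [u] eliminates [M] from the
   [v]-derivative of [H], without ever differentiating [W] in [u]. *)
Let H_derive i u v : Q u v -> is_derive (H i u) v
  (isum s (fun j => N i j u v * H j u v)
   - RInt (fun x => isum s (fun j => pu (N i j) x v * H j x v)) u0 u).
Proof.
intros Hq. pose proof (Q_center v (proj2 Hq)) as Hq0.
replace (isum s (fun j => N i j u v * H j u v)
   - RInt (fun x => isum s (fun j => pu (N i j) x v * H j x v)) u0 u)
 with (NW i u v - (NW i u0 v + RInt (fun x => dMW i x v) u0 u)).
- apply is_derive_Rminus; [apply HWv, Hq|].
  apply (is_derive_plus (fun y => W i u0 y)); [apply HWv, Hq0|].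
  apply RInt_MW_derive_v, Hq.
- pose (dP := fun x => isum s (fun j => pu (N i j) x v * K j x v) +
                       isum s (fun j => N i j x v * MW j x v)).
  assert (HP : is_RInt dP u0 u
    (isum s (fun j => N i j u v * K j u v) - isum s (fun j => N i j u0 v * K j u0 v))).
  { apply (is_RInt_derive (fun x => isum s (fun j => N i j x v * K j x v))).
    - intros t Ht. pose proof (Q_between _ _ _ Hq Ht) as Hqt. unfold dP.
      rewrite <- isum_plus. apply (isum_is_derive s (fun j x => N i j x v * K j x v)).
      intros j. apply (is_derive_Rmult (fun x => N i j x v) (fun x => K j x v)).
      + apply (Derive_correct (fun x => N i j x v)), HNu, Hqt.
      + apply K_derive, Hqt.
    - intros t Ht. pose proof (Q_between _ _ _ Hq Ht) as Hqt.
      apply (continuous_plus (V := R_NormedModule)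
        (fun x => isum s (fun j => pu (N i j) x v * K j x v))
        (fun x => isum s (fun j => N i j x v * MW j x v))).
      + apply (isum_mult_continuous s (fun j x => pu (N i j) x v) (fun j x => K j x v)); auto.
        intros j. apply (continuous_slice_l (pu (N i j))), HNuc, Hqt.
      + apply (isum_mult_continuous s (fun j x => N i j x v) (fun j x => MW j x v)); intros j.
        * apply (continuous_slice_l (N i j)), HN, Hqt.
        * apply (continuous_slice_l (MW j)), MW_continuous, Hqt. }
  assert (HD : ex_RInt (fun x => dMW i x v) u0 u).
  { apply (ex_RInt_continuous (V := R_CompleteNormedModule)). intros t Ht.
    apply (continuous_slice_l (dMW i)), dMW_continuous, (Q_between _ _ _ Hq Ht). }
  rewrite (RInt_ext (fun x => isum s (fun j => pu (N i j) x v * H j x v))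
    (fun x => minus (dMW i x v) (dP x))).
  + rewrite (RInt_minus (V := R_CompleteNormedModule) (fun x => dMW i x v) dP);
      [|exact HD|eexists; exact HP].
    rewrite (is_RInt_unique dP _ _ _ HP).
    change (minus ?x ?y) with (x - y).
    rewrite (isum_ext s (fun j => N i j u v * H j u v)
      (fun j => N i j u v * W j u v - N i j u v * K j u v))
      by (intros; unfold H; ring).
    rewrite isum_minus.
    rewrite (isum_ext s (fun j => N i j u0 v * K j u0 v) (fun j => N i j u0 v * W j u0 v)).
    * unfold NW. ring.
    * intros j. unfold K. rewrite RInt_point. change (@zero _) with 0. ring.
  + intros t Ht. change (minus ?x ?y) with (x - y). unfold dMW, dP.
    rewrite (isum_ext s (fun j => pu (N i j) t v * H j t v)
      (fun j => pu (N i j) t v * W j t v - pu (N i j) t v * K j t v))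
      by (intros; unfold H; ring).
    rewrite isum_minus. match goal with |- ?a = ?b => change (@eq R a b) end. ring.
Qed.

(** On the initial line the [u]-equation is given, so this is the fundamental theorem of
    calculus. *)
Let H_v0 i u : Q u v0 -> H i u v0 = 0.
Proof.
intros Hq. unfold H, K.
enough (E : RInt (fun x => MW i x v0) u0 u = W i u v0 - W i u0 v0) by lra.
apply is_RInt_unique. apply (is_RInt_derive (fun x => W i x v0)).
- intros t Ht. apply HWu. apply (Q_between _ _ _ Hq Ht).
- intros t Ht. apply (continuous_slice_l (MW i)), MW_continuous, (Q_between _ _ _ Hq Ht).
Qed.

(** At [k = 0] the three terms of [H] are bounded directly, using [r <= 1] for the integral. In the
    step, a bound [b] on [H] gives [L * (C * b)] for [N H] and at most as much for the integral of
    [N_u H]; the mean value inequality from [H(u, v0) = 0] multiplies the sum by at most [r], and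
    [2 * (L * (C * b)) * r <= b / 2]. *)
Let H_bound (k : nat) : forall i u v, Q u v ->
  Rabs (H i u v) <= (2 * B + INR (length s) * (C * B)) * (1 / 2) ^ k.
Proof.
set (L := INR (length s)) in *.
assert (HL : 0 <= L) by apply pos_INR.
induction k as [|k IH]; intros i u v Hq.
- assert (HC0 : 0 <= C) by (eapply Rle_trans; [apply Rabs_pos | apply (HMC i i u v Hq)]).
  assert (HB0 : 0 <= B) by (eapply Rle_trans; [apply Rabs_pos | apply (HWB i u v)]).
  pose proof (HWB i u v). pose proof (HWB i u0 v).
  assert (Rabs (RInt (fun x => MW i x v) u0 u) <= L * (C * B)).
  { eapply Rle_trans; [apply (RInt_bound _ _ _ (L * (C * B)))|].
    - apply MW_integrable, Hq.
    - intros t Ht. apply isum_mult_bound; auto. intros j. apply HMC, (Q_between _ _ _ Hq Ht).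
    - destruct Hq as [Hu _]. assert (0 <= L * (C * B)) by (repeat apply Rmult_le_pos; auto).
      rewrite <- (Rmult_1_l (L * (C * B))) at 2. apply Rmult_le_compat_r; lra. }
  unfold H, K. simpl. rewrite Rmult_1_r.
  revert H0 H1 H2. generalize (RInt (fun x => MW i x v) u0 u). intros; split_Rabs; lra.
- set (b := (2 * B + L * (C * B)) * (1 / 2) ^ k) in *.
  assert (Hb : 0 <= b) by (eapply Rle_trans; [apply Rabs_pos | apply (IH i u v Hq)]).
  assert (HC0 : 0 <= C) by (eapply Rle_trans; [apply Rabs_pos | apply (HMC i i u v Hq)]).
  pose proof (H_v0 i u) as E0.
  assert (Hqc : Q u v0) by (split; [apply Hq | rewrite Rminus_diag, Rabs_R0; lra]).
  specialize (E0 Hqc).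
  rewrite <- (Rminus_0_r (H i u v)), <- E0.
  assert (HLCb : 0 <= L * (C * b)) by (apply Rmult_le_pos; [|apply Rmult_le_pos]; assumption).
  apply Rle_trans with (2 * (L * (C * b)) * Rabs (v - v0)).
  + apply (bounded_variation (H i u) (fun y => isum s (fun j => N i j u y * H j u y)
      - RInt (fun x => isum s (fun j => pu (N i j) x y * H j x y)) u0 u)).
    intros t Ht.
    assert (Hqt : Q u t) by (split; [apply Hq | destruct Hq; lra]).
    split; [apply H_derive, Hqt|].
    eapply Rle_trans; [apply Rabs_triang|]. rewrite Rabs_Ropp.
    replace (2 * (L * (C * b))) with (L * (C * b) + 1 * (L * (C * b))) by ring.
    apply Rplus_le_compat.
    * apply isum_mult_bound; auto.
    * eapply Rle_trans; [apply (RInt_bound _ _ _ (L * (C * b)))|].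
      -- apply NuH_integrable, Hqt.
      -- intros x Hx. pose proof (Q_between _ _ _ Hqt Hx). apply isum_mult_bound; auto.
      -- apply Rmult_le_compat_r; [exact HLCb | destruct Hq; lra].
  + apply Rle_trans with (2 * (L * (C * b)) * r).
    * apply Rmult_le_compat_l; [lra | destruct Hq; lra].
    * replace (2 * (L * (C * b)) * r) with (b / 2 * (4 * (r * (L * C)))) by field.
      apply Rle_trans with (b / 2 * 1); [apply Rmult_le_compat_l; lra|].
      unfold b. simpl. lra.
Qed.

Lemma compatible_is_derive_u i u v : Q u v ->
  is_derive (fun x => W i x v) u (isum s (fun j => M i j u v * W j u v)).
Proof.
intros Hq. apply (is_derive_ext_loc (fun x => K i x v)); [|apply K_derive, Hq].
generalize (locally_Rabs_lt _ _ _ (proj1 Hq)). apply filter_imp. intros x Hx.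
symmetry. apply Rminus_diag_uniq. fold (H i x v).
apply (eq_0_of_le_half_pow (2 * B + INR (length s) * (C * B))). intros k.
apply H_bound. split; [exact Hx | apply Hq].
Qed.

End Compatibility.

(** Finite-order version of [smooth_on]: it allows induction on the order of differentiability,
    which the bootstrapping of the linear system requires. *)
Fixpoint ck_on (k : nat) (D : R -> R -> Prop) (f : R -> R -> R) : Prop :=
  (forall u v, D u v -> continuous (fun p : R * R => f (fst p) (snd p)) (u, v)) /\
  match k with
  | O => True
  | S k' =>
      (forall u v, D u v -> ex_derive (fun x => f x v) u /\ ex_derive (f u) v) /\
      ck_on k' D (pu f) /\ ck_on k' D (pv f)
  end.

Lemma ck_on_continuous k D f u v : ck_on k D f -> D u v ->
  continuous (fun p : R * R => f (fst p) (snd p)) (u, v).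
Proof. destruct k; intros [H _]; apply H. Qed.

Lemma ck_on_pu k D f : ck_on (S k) D f -> ck_on k D (pu f).
Proof. intros [_ [_ [H _]]]. exact H. Qed.

Lemma ck_on_pv k D f : ck_on (S k) D f -> ck_on k D (pv f).
Proof. intros [_ [_ [_ H]]]. exact H. Qed.

Lemma ck_on_ex_derive_u k D f u v : ck_on (S k) D f -> D u v -> ex_derive (fun x => f x v) u.
Proof. intros [_ [H _]] Huv. apply (H u v Huv). Qed.

Lemma ck_on_ex_derive_v k D f u v : ck_on (S k) D f -> D u v -> ex_derive (f u) v.
Proof. intros [_ [H _]] Huv. apply (H u v Huv). Qed.

(** * Local solvability of compatible linear systems *)

Lemma locally_Rabs_bound {U : UniformSpace} (f : U -> R) (x : U) (B : R) :
  continuous f x -> Rabs (f x) <= B -> locally x (fun y => Rabs (f y) <= B + 1).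
Proof.
intros Hf HB.
generalize (proj1 (filterlim_locally _ _) Hf (mkposreal 1 Rlt_0_1)).
apply filter_imp. intros y Hy. change (Rabs (f y - f x) < 1) in Hy.
revert HB Hy. generalize (f x), (f y). intros. split_Rabs; lra.
Qed.

(** The order of quantifiers matters: [r] is chosen before [w0], so solutions with different initial
    values share one square. *)
Theorem linear_frobenius {I : Type} (s : list I) (Hs : forall i, In i s)
  (D : R -> R -> Prop) (HD : open (as_set D)) (M N : I -> I -> R -> R -> R)
  (HM : forall i j, ck_on 1 D (M i j)) (HN : forall i j, ck_on 1 D (N i j))
  (Hflat : forall i (w : I -> R) u v, D u v ->
     isum s (fun j => pv (M i j) u v * w j) +
     isum s (fun j => M i j u v * isum s (fun k => N j k u v * w k)) =
     isum s (fun j => pu (N i j) u v * w j) +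
     isum s (fun j => N i j u v * isum s (fun k => M j k u v * w k)))
  (u0 v0 : R) (H0 : D u0 v0) :
  exists r, 0 < r /\ (forall u v, square u0 v0 r u v -> D u v) /\
    forall w0 : I -> R, exists W : I -> R -> R -> R,
      (forall i, W i u0 v0 = w0 i) /\
      forall i u v, square u0 v0 r u v ->
        continuous (fun p : R * R => W i (fst p) (snd p)) (u, v) /\
        is_derive (fun x => W i x v) u (isum s (fun j => M i j u v * W j u v)) /\
        is_derive (W i u) v (isum s (fun j => N i j u v * W j u v)).
Proof.
pose (s2 := list_prod s s).
assert (Hs2 : forall ij : I * I, In ij s2) by (intros [i j]; apply in_prod; apply Hs).
destruct (finite_bound s2 Hs2 (fun ij => M (fst ij) (snd ij) u0 v0)) as [B1 [HB1 HMB]].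
destruct (finite_bound s2 Hs2 (fun ij => N (fst ij) (snd ij) u0 v0)) as [B2 [HB2 HNB]].
destruct (finite_bound s2 Hs2 (fun ij => pu (N (fst ij) (snd ij)) u0 v0)) as [B3 [HB3 HNuB]].
(* The sum dominates the values of all coefficients at the centre; the extra 1 is the margin that
   continuity needs to extend the bound to a neighbourhood. *)
set (C := B1 + B2 + B3 + 1).
assert (Hloc : locally ((u0, v0) : R * R) (fun p => D (fst p) (snd p) /\
  forall ij : I * I, Rabs (M (fst ij) (snd ij) (fst p) (snd p)) <= C /\
    Rabs (N (fst ij) (snd ij) (fst p) (snd p)) <= C /\
    Rabs (pu (N (fst ij) (snd ij)) (fst p) (snd p)) <= C)).
{ apply filter_and; [exact (HD (u0, v0) H0)|].
  apply (locally_finite_forall s2 Hs2 _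
    (fun ij p => Rabs (M (fst ij) (snd ij) (fst p) (snd p)) <= C /\
    Rabs (N (fst ij) (snd ij) (fst p) (snd p)) <= C /\
    Rabs (pu (N (fst ij) (snd ij)) (fst p) (snd p)) <= C)).
  intros ij. repeat apply filter_and.
  - apply (locally_Rabs_bound (fun p : R * R => M (fst ij) (snd ij) (fst p) (snd p))).
    + apply (ck_on_continuous 1 D); [auto | exact H0].
    + eapply Rle_trans; [apply (HMB ij)|lra].
  - apply (locally_Rabs_bound (fun p : R * R => N (fst ij) (snd ij) (fst p) (snd p))).
    + apply (ck_on_continuous 1 D); [auto | exact H0].
    + eapply Rle_trans; [apply (HNB ij)|lra].
  - apply (locally_Rabs_bound (fun p : R * R => pu (N (fst ij) (snd ij)) (fst p) (snd p))).
    + apply (ck_on_continuous 0 D); [apply ck_on_pu, HN | exact H0].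
    + eapply Rle_trans; [apply (HNuB ij)|lra]. }
destruct Hloc as [d Hd].
set (L := INR (length s)).
assert (HLC : 0 <= L * C) by (apply Rmult_le_pos; [apply pos_INR | unfold C; lra]).
(* [d / 2] puts even the closed square inside the ball where the bounds hold, 1 controls the lengths
   of the [u]-integrals, and the last term gives [4 * (r * (L * C)) <= 1], its [+ 1] keeping the
   denominator positive. *)
set (r := Rmin (d / 2) (Rmin 1 (/ (4 * (L * C + 1))))).
assert (Hr4 : 0 < / (4 * (L * C + 1))) by (apply Rinv_0_lt_compat; lra).
assert (Hr : 0 < r).
{ repeat apply Rmin_glb_lt; [destruct d; simpl; lra | lra | exact Hr4]. }
assert (Hrd : r < d).
{ eapply Rle_lt_trans; [apply Rmin_l | destruct d; simpl; lra]. }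
assert (Hr1 : r <= 1) by (eapply Rle_trans; [apply Rmin_r | apply Rmin_l]).
assert (HrC : 4 * (r * (L * C)) <= 1).
{ assert (Hrr : r <= / (4 * (L * C + 1))) by (eapply Rle_trans; [apply Rmin_r | apply Rmin_r]).
  apply (Rmult_le_compat_l (4 * (L * C + 1))) in Hrr; [|lra].
  rewrite Rinv_r in Hrr by lra. nra. }
assert (Hsq : forall u v, Rabs (u - u0) <= r -> Rabs (v - v0) <= r ->
  D u v /\ forall i j, Rabs (M i j u v) <= C /\ Rabs (N i j u v) <= C /\
    Rabs (pu (N i j) u v) <= C).
{ intros u v Hu Hv.
  destruct (Hd (u, v)) as [HDuv HC].
  - split; [change (Rabs (u - u0) < d) | change (Rabs (v - v0) < d)]; lra.
  - split; [exact HDuv | intros i j; exact (HC (i, j))]. }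
assert (HQ : forall u v, square u0 v0 r u v ->
  D u v /\ forall i j, Rabs (M i j u v) <= C /\ Rabs (N i j u v) <= C /\
    Rabs (pu (N i j) u v) <= C).
{ intros u v [Hu Hv]. apply Hsq; lra. }
exists r. split; [exact Hr|split; [intros u v Huv; apply (HQ u v Huv)|]]. intros w0.
(* [picard] wants coefficients that are continuous and bounded on the whole plane. Clamping the
   arguments provides this; the clamped point may lie on the boundary, which is why [Hsq] covers the
   closed square. *)
pose (ext := fun (f : R -> R -> R) u v => f (clamp u0 r u) (clamp v0 r v)).
assert (Hclamp : forall u v, D (clamp u0 r u) (clamp v0 r v) /\
  forall i j, Rabs (ext (M i j) u v) <= C /\ Rabs (ext (N i j) u v) <= C).
{ intros u v. destruct (Hsq (clamp u0 r u) (clamp v0 r v)) as [HDuv HC];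
    [apply clamp_bound; lra | apply clamp_bound; lra|].
  split; [exact HDuv | intros i j; split; apply HC]. }
assert (Hext : forall f, ck_on 1 D f ->
  forall p, continuous (fun p : R * R => ext f (fst p) (snd p)) p).
{ intros f Hf [u v].
  apply (continuous_comp_2 (fun p : R * R => clamp u0 r (fst p))
    (fun p => clamp v0 r (snd p)) f).
  - apply (continuous_comp fst (clamp u0 r)); [apply continuous_fst | apply clamp_continuous].
  - apply (continuous_comp snd (clamp v0 r)); [apply continuous_snd | apply clamp_continuous].
  - apply (ck_on_continuous 1 D); [exact Hf | apply Hclamp]. }
assert (Heq : forall f u v, Rabs (u - u0) <= r -> Rabs (v - v0) <= r -> ext f u v = f u v).
{ intros f u v Hu Hv. unfold ext. rewrite !clamp_id by assumption. reflexivity. }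
assert (Hv00 : Rabs (v0 - v0) <= r) by (rewrite Rminus_diag, Rabs_R0; lra).
destruct (picard s Hs (fun i j => ext (M i j)) (fun i j => ext (N i j)) C r u0 v0)
  with (w0 := w0) as [W [B [HW [HWB [HW0 [HWu HWv]]]]]]; auto.
{ intros i j u v. apply Hclamp. }
{ intros i j u v. apply Hclamp. }
exists W. split; [exact HW0|].
assert (HWv' : forall i u v, square u0 v0 r u v ->
  is_derive (W i u) v (isum s (fun j => N i j u v * W j u v))).
{ intros i u v [Hu Hv]. rewrite (isum_ext s _ (fun j => ext (N i j) u v * W j u v)).
  - apply HWv, Hv.
  - intros j. rewrite Heq by lra. reflexivity. }
intros i u v Huv. split; [apply HW | split; [|apply HWv', Huv]].
apply (compatible_is_derive_u s M N u0 v0 r C B W); auto.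
- intros a b x y Hxy. apply (ck_on_continuous 1 D); [apply HM | apply HQ, Hxy].
- intros a b x y Hxy. apply (ck_on_continuous 1 D); [apply HN | apply HQ, Hxy].
- intros a b x y Hxy. apply (ck_on_ex_derive_v 0 D); [apply HM | apply HQ, Hxy].
- intros a b x y Hxy. apply (ck_on_ex_derive_u 0 D); [apply HN | apply HQ, Hxy].
- intros a b x y Hxy. apply (ck_on_continuous 0 D); [apply ck_on_pu, HN | apply HQ, Hxy].
- intros a b x y Hxy. apply HQ, Hxy.
- intros a b x y Hxy. apply HQ, Hxy.
- intros a b x y Hxy. apply HQ, Hxy.
- intros a w x y Hxy. apply Hflat, HQ, Hxy.
- intros a x Hx. rewrite (isum_ext s _ (fun j => ext (M a j) x v0 * W j x v0)).
  + apply HWu, Hx.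
  + intros j. rewrite Heq by lra. reflexivity.
Qed.

(** * Smoothness *)

Lemma iter_partial_app (l : list bool) (c : bool) f :
  iter_partial (l ++ c :: nil) f = iter_partial l ((if c then pu else pv) f).
Proof. induction l as [|d l IH]; [reflexivity|]. simpl. rewrite IH. reflexivity. Qed.

(** [iter_partial] applies the head of the word last, whereas [ck_on] strips the derivative applied
    first; hence the induction from the right end of the word. *)
Lemma smooth_on_ck D f : smooth_on D f <-> forall k, ck_on k D f.
Proof.
split.
- intros H k. revert f H. induction k as [|k IH]; intros f H.
  + split; [|exact Logic.I]. intros u v Huv. apply (H nil u v Huv).
  + assert (Hp : forall c, smooth_on D ((if c : bool then pu else pv) f)).
    { intros c l u v Huv. rewrite <- iter_partial_app. apply H, Huv. }
    split; [|split; [|split]].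
    * intros u v Huv. apply (H nil u v Huv).
    * intros u v Huv. apply (H nil u v Huv).
    * apply IH, (Hp true).
    * apply IH, (Hp false).
- intros H l. revert f H. induction l as [|c l IH] using rev_ind; intros f H u v Huv.
  + split; [|split].
    * apply (ck_on_continuous 0 D); auto.
    * apply (ck_on_ex_derive_u 0 D); auto.
    * apply (ck_on_ex_derive_v 0 D); auto.
  + rewrite iter_partial_app. apply IH; [|exact Huv]. intros k.
    destruct c; [apply ck_on_pu | apply ck_on_pv]; apply H.
Qed.

Lemma ck_on_pred k D f : ck_on (S k) D f -> ck_on k D f.
Proof.
revert f. induction k as [|k IH]; intros f [Hc [Hd [Hu Hv]]].
- split; auto.
- split; [|split; [|split]]; auto.
Qed.

Lemma ck_on_subset k (D D' : R -> R -> Prop) f :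
  (forall u v, D' u v -> D u v) -> ck_on k D f -> ck_on k D' f.
Proof.
intros HD. revert f. induction k as [|k IH]; intros f [Hc Hk].
- split; auto.
- destruct Hk as [Hd [Hu Hv]]. split; [|split; [|split]]; auto.
Qed.

Section OnOpen.

Context (D : R -> R -> Prop) (HD : open (as_set D)).

Lemma open_slice_u u v : D u v -> locally u (fun x => D x v).
Proof.
intros H. destruct (HD (u, v) H) as [d Hd]. exists d. intros x Hx.
apply (Hd (x, v)). split; [exact Hx | apply ball_center].
Qed.

Lemma open_slice_v u v : D u v -> locally v (D u).
Proof.
intros H. destruct (HD (u, v) H) as [d Hd]. exists d. intros x Hx.
apply (Hd (u, x)). split; [apply ball_center | exact Hx].
Qed.

(** Since [D] is open, equality on [D] is equality near each of its points, and so passes to the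
    partial derivatives. *)
Lemma ck_on_ext k f g : (forall u v, D u v -> f u v = g u v) -> ck_on k D f -> ck_on k D g.
Proof.
revert f g. induction k as [|k IH]; intros f g Hfg Hf.
all: assert (Hc : forall u v, D u v ->
  continuous (fun p : R * R => g (fst p) (snd p)) (u, v))
  by (intros u v Huv;
  refine (continuous_ext_loc (fun p : R * R => g (fst p) (snd p))
    (fun p : R * R => f (fst p) (snd p)) (u, v) _ _);
  [generalize (HD (u, v) Huv); apply filter_imp; intros p Hp; apply Hfg, Hp
  | apply (ck_on_continuous _ D _ _ _ Hf Huv)]).
- split; [exact Hc | exact Logic.I].
- assert (Hlu : forall u v, D u v -> locally u (fun x => f x v = g x v)).
  { intros u v Huv. generalize (open_slice_u u v Huv). apply filter_imp. auto. }
  assert (Hlv : forall u v, D u v -> locally v (fun x => f u x = g u x)).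
  { intros u v Huv. generalize (open_slice_v u v Huv). apply filter_imp. auto. }
  destruct Hf as [_ [Hd [Hu Hv]]].
  split; [exact Hc|split; [|split]].
  + intros u v Huv. destruct (Hd u v Huv) as [H1 H2]. split.
    * apply (ex_derive_ext_loc (fun x => f x v)); auto.
    * apply (ex_derive_ext_loc (f u)); auto.
  + apply (IH (pu f)); auto. intros u v Huv. apply Derive_ext_loc, Hlu, Huv.
  + apply (IH (pv f)); auto. intros u v Huv. apply Derive_ext_loc, Hlv, Huv.
Qed.

Lemma ck_on_intro k f fu fv :
  (forall u v, D u v -> continuous (fun p : R * R => f (fst p) (snd p)) (u, v)) ->
  (forall u v, D u v -> is_derive (fun x => f x v) u (fu u v)) ->
  (forall u v, D u v -> is_derive (f u) v (fv u v)) ->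
  ck_on k D fu -> ck_on k D fv -> ck_on (S k) D f.
Proof.
intros Hc Hu Hv Hfu Hfv. split; [exact Hc|split; [|split]].
- intros u v Huv. split; eexists; eauto.
- apply (ck_on_ext k fu); [|exact Hfu].
  intros u v Huv. symmetry. apply is_derive_unique; auto.
- apply (ck_on_ext k fv); [|exact Hfv].
  intros u v Huv. symmetry. apply is_derive_unique; auto.
Qed.

Lemma ck_on_is_derive_u k f u v : ck_on (S k) D f -> D u v ->
  is_derive (fun x => f x v) u (pu f u v).
Proof. intros Hf Huv. apply (Derive_correct (fun x => f x v)), (ck_on_ex_derive_u k D); auto. Qed.

Lemma ck_on_is_derive_v k f u v : ck_on (S k) D f -> D u v ->
  is_derive (f u) v (pv f u v).
Proof. intros Hf Huv. apply (Derive_correct (f u)), (ck_on_ex_derive_v k D); auto. Qed.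

Lemma ck_on_const k c : ck_on k D (fun _ _ => c).
Proof.
revert c. induction k as [|k IH]; intros c.
- split; [|exact Logic.I]. intros. apply continuous_const.
- apply ck_on_intro with (fun _ _ => 0) (fun _ _ => 0); auto.
  + intros. apply continuous_const.
  + intros. apply (is_derive_const (V := R_NormedModule)).
  + intros. apply (is_derive_const (V := R_NormedModule)).
Qed.

Lemma ck_on_plus k f g : ck_on k D f -> ck_on k D g -> ck_on k D (fun u v => f u v + g u v).
Proof.
revert f g. induction k as [|k IH]; intros f g Hf Hg.
all: assert (Hc : forall u v, D u v ->
  continuous (fun p : R * R => f (fst p) (snd p) + g (fst p) (snd p)) (u, v))
  by (intros u v Huv; apply (continuous_plus (V := R_NormedModule)
        (fun p : R * R => f (fst p) (snd p)) (fun p : R * R => g (fst p) (snd p)));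
      eapply ck_on_continuous; eassumption).
- split; auto.
- apply ck_on_intro with (fun u v => pu f u v + pu g u v) (fun u v => pv f u v + pv g u v);
    auto using ck_on_pu, ck_on_pv.
  + intros u v Huv. apply (is_derive_plus (fun x => f x v) (fun x => g x v));
      eapply ck_on_is_derive_u; eassumption.
  + intros u v Huv. apply (is_derive_plus (f u) (g u)); eapply ck_on_is_derive_v; eassumption.
Qed.

Lemma ck_on_mult k f g : ck_on k D f -> ck_on k D g -> ck_on k D (fun u v => f u v * g u v).
Proof.
revert f g. induction k as [|k IH]; intros f g Hf Hg.
all: assert (Hc : forall u v, D u v ->
  continuous (fun p : R * R => f (fst p) (snd p) * g (fst p) (snd p)) (u, v))
  by (intros u v Huv; apply (continuous_mult (K := R_AbsRing)
        (fun p : R * R => f (fst p) (snd p)) (fun p : R * R => g (fst p) (snd p)));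
      eapply ck_on_continuous; eassumption).
- split; auto.
- apply ck_on_intro with (fun u v => pu f u v * g u v + f u v * pu g u v)
    (fun u v => pv f u v * g u v + f u v * pv g u v);
    auto using ck_on_pu, ck_on_pv, ck_on_plus, ck_on_pred.
  + intros u v Huv. apply (is_derive_Rmult (fun x => f x v) (fun x => g x v));
      eapply ck_on_is_derive_u; eassumption.
  + intros u v Huv. apply (is_derive_Rmult (f u) (g u)); eapply ck_on_is_derive_v; eassumption.
Qed.

Lemma ck_on_opp k f : ck_on k D f -> ck_on k D (fun u v => - f u v).
Proof.
intros Hf. apply (ck_on_ext k (fun u v => -1 * f u v)); [intros; ring|].
apply ck_on_mult; [apply ck_on_const | exact Hf].
Qed.

Lemma ck_on_minus k f g : ck_on k D f -> ck_on k D g -> ck_on k D (fun u v => f u v - g u v).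
Proof. intros Hf Hg. apply (ck_on_plus k f); [|apply ck_on_opp]; assumption. Qed.

(** The derivative is written as a product with [/ f * / f] and not as a quotient by [f ^ 2], so
    that the induction hypothesis for [/ f] applies to it. *)
Lemma ck_on_inv k f : (forall u v, D u v -> f u v <> 0) ->
  ck_on k D f -> ck_on k D (fun u v => / f u v).
Proof.
intros Hn. revert f Hn. induction k as [|k IH]; intros f Hn Hf.
all: assert (Hc : forall u v, D u v ->
  continuous (fun p : R * R => / f (fst p) (snd p)) (u, v))
  by (intros u v Huv; apply (continuous_comp (fun p : R * R => f (fst p) (snd p)) Rinv);
      [eapply ck_on_continuous; eassumption | apply continuous_Rinv, Hn, Huv]).
- split; auto.
- assert (Hd : forall h, ck_on (S k) D f -> ck_on k D h ->
    ck_on k D (fun u v => - (h u v * (/ f u v * / f u v)))).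
  { intros h Hf' Hh. apply ck_on_opp, (ck_on_mult k h); [exact Hh|].
    apply ck_on_mult; apply IH; auto using ck_on_pred. }
  apply ck_on_intro with (fun u v => - (pu f u v * (/ f u v * / f u v)))
    (fun u v => - (pv f u v * (/ f u v * / f u v))); auto using ck_on_pu, ck_on_pv.
  + intros u v Huv. replace (- (pu f u v * (/ f u v * / f u v))) with (- pu f u v / f u v ^ 2)
      by (field; auto).
    apply (is_derive_inv (fun x => f x v)); auto. eapply ck_on_is_derive_u; eassumption.
  + intros u v Huv. replace (- (pv f u v * (/ f u v * / f u v))) with (- pv f u v / f u v ^ 2)
      by (field; auto).
    apply (is_derive_inv (f u)); auto. eapply ck_on_is_derive_v; eassumption.
Qed.

Lemma ck_on_isum {I} (s : list I) k (f : I -> R -> R -> R) :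
  (forall i, ck_on k D (f i)) -> ck_on k D (fun u v => isum s (fun i => f i u v)).
Proof.
intros H. induction s as [|a s IH]; [exact (ck_on_const k 0)|].
apply (ck_on_plus k (f a) (fun u v => isum s (fun i => f i u v))); auto.
Qed.

(** Bootstrapping: the equations express both partial derivatives of [W] through [W] and smooth
    coefficients, so each order of regularity of [W] yields the next. *)
Lemma linear_system_smooth {I} (s : list I) (M N : I -> I -> R -> R -> R) (W : I -> R -> R -> R) :
  (forall i j k, ck_on k D (M i j)) -> (forall i j k, ck_on k D (N i j)) ->
  (forall i u v, D u v ->
     continuous (fun p : R * R => W i (fst p) (snd p)) (u, v) /\
     is_derive (fun x => W i x v) u (isum s (fun j => M i j u v * W j u v)) /\
     is_derive (W i u) v (isum s (fun j => N i j u v * W j u v))) ->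
  forall i, smooth_on D (W i).
Proof.
intros HM HN HW i. apply smooth_on_ck. intros k. revert i.
induction k as [|k IH]; intros i.
- split; [|exact Logic.I]. intros u v Huv. apply HW, Huv.
- apply ck_on_intro with (fun u v => isum s (fun j => M i j u v * W j u v))
    (fun u v => isum s (fun j => N i j u v * W j u v)).
  + intros u v Huv. apply HW, Huv.
  + intros u v Huv. apply HW, Huv.
  + intros u v Huv. apply HW, Huv.
  + apply (ck_on_isum s k (fun j u v => M i j u v * W j u v)). intros j.
    apply ck_on_mult; auto.
  + apply (ck_on_isum s k (fun j u v => N i j u v * W j u v)). intros j.
    apply ck_on_mult; auto.
Qed.

End OnOpen.

(** * Squares as domains *)

Lemma square_center (u0 v0 r : R) : 0 < r -> square u0 v0 r u0 v0.
Proof. intros Hr. split; rewrite Rminus_diag, Rabs_R0; exact Hr. Qed.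

Lemma eq_of_is_derive_0 (f : R -> R) (a b : R) :
  (forall t, Rabs (t - a) <= Rabs (b - a) -> is_derive f t 0) -> f b = f a.
Proof.
intros H. apply Rminus_diag_uniq.
pose proof (bounded_variation f (fun _ => 0) 0 a b) as Hb.
rewrite Rmult_0_l in Hb.
assert (Hle : Rabs (f b - f a) <= 0).
{ apply Hb. intros t Ht. rewrite Rabs_R0. split; [apply H, Ht | lra]. }
pose proof (Rabs_pos (f b - f a)). split_Rabs; lra.
Qed.

(** Any point is joined to the centre inside the square by a vertical and then a horizontal
    segment. *)
Lemma constant_on_square (u0 v0 r : R) (f : R -> R -> R) :
  (forall u v, square u0 v0 r u v ->
     is_derive (fun x => f x v) u 0 /\ is_derive (f u) v 0) ->
  forall u v, square u0 v0 r u v -> f u v = f u0 v0.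
Proof.
intros H u v [Hu Hv]. transitivity (f u v0).
- apply eq_of_is_derive_0. intros t Ht. apply H. split; lra.
- apply (eq_of_is_derive_0 (fun x => f x v0)). intros t Ht.
  apply (H t v0). split; [lra | rewrite Rminus_diag, Rabs_R0].
  eapply Rle_lt_trans; [apply Rabs_pos | exact Hv].
Qed.

(* Along a segment issued from the centre, the indicator of [A] is locally constant, so its
   derivative vanishes. *)
Lemma square_connected (u0 v0 r : R) : connected_set (as_set (square u0 v0 r)).
Proof.
intros A B HA HB Hcov Hdisj.
(* Stated for arbitrary [A] and [B], because either of the two sets may be the one containing the
   centre. *)
assert (Key : forall A B : R * R -> Prop, open A -> open B ->
  (forall p, as_set (square u0 v0 r) p -> A p \/ B p) ->
  (forall p, as_set (square u0 v0 r) p -> A p -> B p -> False) ->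
  A (u0, v0) -> forall p, as_set (square u0 v0 r) p -> A p).
{ clear. intros A B HA HB Hcov Hdisj H0 [u v] Hp.
  pose (h := fun t => (u0 + t * (u - u0), v0 + t * (v - v0))).
  assert (Hline : forall a w t, continuous (fun t => a + t * w) t).
  { intros a w t. apply (ex_derive_continuous (V := R_NormedModule)). auto_derive. exact Logic.I. }
  assert (Hh : forall t (P : R * R -> Prop), locally (h t) P -> locally t (fun x => P (h x))).
  { intros t P [d Hd].
    generalize (filter_and _ _
      (proj1 (filterlim_locally _ _) (Hline u0 (u - u0) t) d)
      (proj1 (filterlim_locally _ _) (Hline v0 (v - v0) t) d)).
    apply filter_imp. intros x [Hx Hy]. apply Hd. split; assumption. }
  assert (HS : forall t, Rabs (t - 0) <= Rabs (1 - 0) -> as_set (square u0 v0 r) (h t)).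
  { intros t Ht. rewrite !Rminus_0_r, Rabs_R1 in Ht. destruct Hp as [Hu Hv]. simpl in Hu, Hv.
    assert (E : forall a w, Rabs w < r -> Rabs (a + t * w - a) < r).
    { intros a w Hw. replace (a + t * w - a) with (t * w) by ring. rewrite Rabs_mult.
      apply Rle_lt_trans with (1 * Rabs w); [|lra].
      apply Rmult_le_compat_r; [apply Rabs_pos | exact Ht]. }
    split; simpl; apply E; assumption. }
  pose (f := fun t => if excluded_middle_informative (A (h t)) then 0 else 1).
  assert (Ef : f 1 = f 0).
  { apply eq_of_is_derive_0. intros t Ht.
    assert (Hloc : locally t (fun x => f t = f x)).
    { specialize (HS t Ht). pose proof (square_open _ _ _ _ HS) as HSloc.
      apply Hh in HSloc. unfold f.
      destruct (excluded_middle_informative (A (h t))) as [HAt|HAt].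
      - generalize (Hh _ _ (HA _ HAt)). apply filter_imp. intros x Hx.
        destruct (excluded_middle_informative (A (h x))); tauto.
      - destruct (Hcov _ HS) as [|HBt]; [contradiction|].
        generalize (filter_and _ _ HSloc (Hh _ _ (HB _ HBt))). apply filter_imp.
        intros x [HSx HBx].
        destruct (excluded_middle_informative (A (h x))) as [HAx|]; [|reflexivity].
        destruct (Hdisj _ HSx HAx HBx). }
    apply (is_derive_ext_loc (fun _ => f t)); [exact Hloc|].
    apply (is_derive_const (V := R_NormedModule)). }
  assert (E1 : h 1 = (u, v)) by (unfold h; f_equal; ring).
  assert (E0 : h 0 = (u0, v0)) by (unfold h; f_equal; ring).
  unfold f in Ef. rewrite E1, E0 in Ef.
  destruct (excluded_middle_informative (A (u, v))) as [HAp|]; [exact HAp|].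
  destruct (excluded_middle_informative (A (u0, v0))); [lra | contradiction]. }
destruct (Rlt_dec 0 r) as [Hr|Hr].
- destruct (Hcov (u0, v0) (square_center _ _ _ Hr)) as [H0|H0].
  + left. apply (Key A B); assumption.
  + right. apply (Key B A); try assumption.
    * intros p Hp. destruct (Hcov p Hp); auto.
    * intros p Hp H1 H2. apply (Hdisj p Hp H2 H1).
- left. intros p [Hp _]. pose proof (Rabs_pos (fst p - u0)). simpl in Hp. lra.
Qed.

Lemma square_plane_domain (u0 v0 r : R) : 0 < r -> plane_domain (square u0 v0 r).
Proof.
intros Hr. split; [|split].
- exists u0, v0. apply square_center, Hr.
- intros p Hp. apply square_open, Hp.
- apply square_connected.
Qed.

(** * Moving frames in R^4 *)

Lemma V4_eq (a b : V4) :
  c0 a = c0 b -> Defs.c1 a = Defs.c1 b -> c2 a = c2 b -> c3 a = c3 b -> a = b.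
Proof. destruct a, b. simpl. intros -> -> -> ->. reflexivity. Qed.

Lemma vdot_comm a b : vdot a b = vdot b a.
Proof. unfold vdot. ring. Qed.

Lemma vdot_vadd_l a b c : vdot (vadd a b) c = vdot a c + vdot b c.
Proof. unfold vdot. simpl. ring. Qed.

Lemma vdot_vadd_r a b c : vdot a (vadd b c) = vdot a b + vdot a c.
Proof. unfold vdot. simpl. ring. Qed.

Lemma vdot_vscal_l k a b : vdot (vscal k a) b = k * vdot a b.
Proof. unfold vdot. simpl. ring. Qed.

Lemma vdot_vscal_r k a b : vdot a (vscal k b) = k * vdot a b.
Proof. unfold vdot. simpl. ring. Qed.

Lemma vdot_pos a : 0 <= vdot a a.
Proof. unfold vdot. nra. Qed.

Lemma vdot_sub_0 a b : vdot (vadd a (vscal (-1) b)) (vadd a (vscal (-1) b)) = 0 -> a = b.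
Proof.
set (d := vadd a (vscal (-1) b)). unfold vdot. intros H.
assert (Hsq : forall x y, 0 <= y -> x * x + y = 0 -> x = 0).
{ intros x y Hy E. apply Rsqr_0_uniq. pose proof (Rle_0_sqr x). unfold Rsqr in *. lra. }
assert (Hd : c0 d = 0 /\ Defs.c1 d = 0 /\ c2 d = 0 /\ c3 d = 0).
{ pose proof (Rle_0_sqr (c0 d)). pose proof (Rle_0_sqr (Defs.c1 d)).
  pose proof (Rle_0_sqr (c2 d)). pose proof (Rle_0_sqr (c3 d)). unfold Rsqr in *.
  repeat split.
  - apply (Hsq _ (Defs.c1 d * Defs.c1 d + c2 d * c2 d + c3 d * c3 d)); lra.
  - apply (Hsq _ (c0 d * c0 d + c2 d * c2 d + c3 d * c3 d)); lra.
  - apply (Hsq _ (c0 d * c0 d + Defs.c1 d * Defs.c1 d + c3 d * c3 d)); lra.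
  - apply (Hsq _ (c0 d * c0 d + Defs.c1 d * Defs.c1 d + c2 d * c2 d)); lra. }
subst d. simpl in Hd. apply V4_eq; lra.
Qed.

Lemma vscal_inv k a b : k <> 0 -> vscal (/ k) a = b -> a = vscal k b.
Proof. intros Hk <-. apply V4_eq; simpl; field; exact Hk. Qed.

(** [pu4] and [pv4] rest on the total function [Derive], whose value does not by itself assert
    differentiability; this relation does. *)
Definition is_derive4 (w : R -> V4) (t : R) (d : V4) : Prop :=
  is_derive (fun s => c0 (w s)) t (c0 d) /\ is_derive (fun s => Defs.c1 (w s)) t (Defs.c1 d) /\
  is_derive (fun s => c2 (w s)) t (c2 d) /\ is_derive (fun s => c3 (w s)) t (c3 d).

Lemma is_derive4_sub w w' t d d' : is_derive4 w t d -> is_derive4 w' t d' ->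
  is_derive4 (fun s => vadd (w s) (vscal (-1) (w' s))) t (vadd d (vscal (-1) d')).
Proof.
assert (H : forall f g df dg, is_derive f t df -> is_derive g t dg ->
  is_derive (fun s => f s + -1 * g s) t (df + -1 * dg)).
{ intros f g df dg Hf Hg. apply (is_derive_plus f); [exact Hf|].
  apply (is_derive_scal g), Hg. }
intros [H0 [H1 [H2 H3]]] [H0' [H1' [H2' H3']]].
split; [|split; [|split]]; apply H; assumption.
Qed.

Lemma is_derive_vdot w w' t d d' : is_derive4 w t d -> is_derive4 w' t d' ->
  is_derive (fun s => vdot (w s) (w' s)) t (vdot d (w' t) + vdot (w t) d').
Proof.
intros [H0 [H1 [H2 H3]]] [H0' [H1' [H2' H3']]].
replace (vdot d (w' t) + vdot (w t) d') with
  ((c0 d * c0 (w' t) + c0 (w t) * c0 d') + (Defs.c1 d * Defs.c1 (w' t) + Defs.c1 (w t) * Defs.c1 d')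
   + (c2 d * c2 (w' t) + c2 (w t) * c2 d') + (c3 d * c3 (w' t) + c3 (w t) * c3 d'))
  by (unfold vdot; ring).
unfold vdot.
apply (is_derive_plus (fun s => c0 (w s) * c0 (w' s) + Defs.c1 (w s) * Defs.c1 (w' s)
  + c2 (w s) * c2 (w' s)));
[apply (is_derive_plus (fun s => c0 (w s) * c0 (w' s) + Defs.c1 (w s) * Defs.c1 (w' s)));
[apply (is_derive_plus (fun s => c0 (w s) * c0 (w' s)))|]|];
apply (is_derive_Rmult (fun s => _ (w s)) (fun s => _ (w' s))); assumption.
Qed.

Lemma pu4_is_derive4 w u v d : is_derive4 (fun s => w s v) u d -> pu4 w u v = d.
Proof.
intros [H0 [H1 [H2 H3]]].
apply V4_eq; apply is_derive_unique; assumption.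
Qed.

Lemma pv4_is_derive4 w u v d : is_derive4 (w u) v d -> pv4 w u v = d.
Proof.
intros [H0 [H1 [H2 H3]]].
apply V4_eq; apply is_derive_unique; assumption.
Qed.

Lemma smooth4_is_derive4 D w u v : smooth4_on D w -> D u v ->
  is_derive4 (fun s => w s v) u (pu4 w u v) /\ is_derive4 (w u) v (pv4 w u v).
Proof.
intros [H0 [H1 [H2 H3]]] Huv.
split; split; [|split; [|split]| |split; [|split]]; apply Derive_correct.
- apply (H0 nil u v Huv).
- apply (H1 nil u v Huv).
- apply (H2 nil u v Huv).
- apply (H3 nil u v Huv).
- apply (H0 nil u v Huv).
- apply (H1 nil u v Huv).
- apply (H2 nil u v Huv).
- apply (H3 nil u v Huv).
Qed.

(** Skewness is built in: the six numbers are the entries above the diagonal of the coefficient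
    matrix. *)
Definition moving_frame (x y b l : R -> V4) (t a12 a13 a14 a23 a24 a34 : R) : Prop :=
  is_derive4 x t (vadd (vscal a12 (y t)) (vadd (vscal a13 (b t)) (vscal a14 (l t)))) /\
  is_derive4 y t (vadd (vscal (- a12) (x t)) (vadd (vscal a23 (b t)) (vscal a24 (l t)))) /\
  is_derive4 b t (vadd (vscal (- a13) (x t)) (vadd (vscal (- a23) (y t)) (vscal a34 (l t)))) /\
  is_derive4 l t (vadd (vscal (- a14) (x t)) (vadd (vscal (- a24) (y t)) (vscal (- a34) (b t)))).

(** [tr ((G - 1)^2)] for the Gram matrix [G], that is, the sum of the squares of all entries of
    [G - 1]; each off-diagonal entry occurs twice. *)
Definition gram_defect (x y b l : V4) : R :=
  (vdot x x - 1) ^ 2 + (vdot y y - 1) ^ 2 + (vdot b b - 1) ^ 2 + (vdot l l - 1) ^ 2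
  + 2 * (vdot x y ^ 2 + vdot x b ^ 2 + vdot x l ^ 2 + vdot y b ^ 2 + vdot y l ^ 2
         + vdot b l ^ 2).

Lemma gram_defect_0 x y b l : gram_defect x y b l = 0 <-> orthonormal4 x y b l.
Proof.
unfold gram_defect, orthonormal4. split.
- intros H.
  pose proof (pow2_ge_0 (vdot x x - 1)). pose proof (pow2_ge_0 (vdot y y - 1)).
  pose proof (pow2_ge_0 (vdot b b - 1)). pose proof (pow2_ge_0 (vdot l l - 1)).
  pose proof (pow2_ge_0 (vdot x y)). pose proof (pow2_ge_0 (vdot x b)).
  pose proof (pow2_ge_0 (vdot x l)). pose proof (pow2_ge_0 (vdot y b)).
  pose proof (pow2_ge_0 (vdot y l)). pose proof (pow2_ge_0 (vdot b l)).
  assert (H0' : forall z, z ^ 2 = 0 -> z = 0)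
    by (intros z Hz; apply Rsqr_0_uniq; rewrite <- Hz; unfold Rsqr; ring).
  repeat split; try (apply H0'; lra); apply Rminus_diag_uniq; apply H0'; lra.
- intros [-> [-> [-> [-> [-> [-> [-> [-> [-> ->]]]]]]]]]. ring.
Qed.

(* If [G] is the Gram matrix and [A] the skew coefficient matrix, then [G' = A G - G A], so
   [tr ((G - 1)^2)] has derivative [2 tr ((G - 1) [A, G - 1]) = 0]. *)
Lemma gram_defect_constant x y b l t a12 a13 a14 a23 a24 a34 :
  moving_frame x y b l t a12 a13 a14 a23 a24 a34 ->
  is_derive (fun s => gram_defect (x s) (y s) (b s) (l s)) t 0.
Proof.
intros [Hx [Hy [Hb Hl]]].
assert (D2 : forall f df c, is_derive f t df ->
  is_derive (fun s => (f s - c) ^ 2) t (2 * (f t - c) * df)).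
{ intros f df c Hf.
  apply (is_derive_ext (fun s => (f s - c) * (f s - c)));
    [intros s; match goal with |- ?p = ?q => change (@eq R p q) end; ring|].
  replace (2 * (f t - c) * df) with ((df - 0) * (f t - c) + (f t - c) * (df - 0)) by ring.
  assert (Hc : is_derive (fun s => f s - c) t (df - 0)).
  { apply (is_derive_Rminus f (fun _ => c)); [exact Hf|].
    apply (is_derive_const (V := R_NormedModule)). }
  apply (is_derive_Rmult (fun s => f s - c) (fun s => f s - c)); exact Hc. }
assert (D2' : forall f df, is_derive f t df ->
  is_derive (fun s => f s ^ 2) t (2 * f t * df)).
{ intros f df Hf. apply (is_derive_ext (fun s => (f s - 0) ^ 2));
    [intros s; match goal with |- ?p = ?q => change (@eq R p q) end; ring|].
  rewrite <- (Rminus_0_r (f t)). apply D2, Hf. }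
assert (Dp : forall f g df dg, is_derive f t df -> is_derive g t dg ->
  is_derive (fun s => f s + g s) t (df + dg)).
{ intros f g df dg Hf Hg. apply (is_derive_plus f g); assumption. }
assert (Ds : forall f df, is_derive f t df -> is_derive (fun s => 2 * f s) t (2 * df)).
{ intros f df Hf. apply (is_derive_scal f), Hf. }
(* The derivative is left open for the differentiation rules to fill in; that it equals 0 remains as
   an algebraic identity. *)
evar (e : R). replace 0 with e; subst e.
{ unfold gram_defect.
  apply Dp; [apply Dp; [apply Dp; [apply Dp|]|]|].
  1-4: apply D2; apply is_derive_vdot; eassumption.
  apply Ds. do 4 (apply Dp; [|apply D2', is_derive_vdot; eassumption]).
  apply Dp; apply D2', is_derive_vdot; eassumption. }
cbv beta.
(* Expanding by bilinearity and fixing the order of the arguments leaves the ten Gram entries as the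
   atoms for [ring]. *)
rewrite !vdot_vadd_l, !vdot_vadd_r, !vdot_vscal_l, !vdot_vscal_r.
rewrite !(vdot_comm (y t) (x t)), !(vdot_comm (b t) (x t)), !(vdot_comm (l t) (x t)),
  !(vdot_comm (b t) (y t)), !(vdot_comm (l t) (y t)), !(vdot_comm (l t) (b t)).
ring.
Qed.

Definition frame_dist2 (x y b l x' y' b' l' : V4) : R :=
  vdot (vadd x (vscal (-1) x')) (vadd x (vscal (-1) x'))
  + vdot (vadd y (vscal (-1) y')) (vadd y (vscal (-1) y'))
  + vdot (vadd b (vscal (-1) b')) (vadd b (vscal (-1) b'))
  + vdot (vadd l (vscal (-1) l')) (vadd l (vscal (-1) l')).

(** The differences of corresponding vectors solve the same linear system, and a skew matrix
    preserves the sum of their squared lengths. *)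
Lemma frame_dist2_constant x y b l x' y' b' l' t a12 a13 a14 a23 a24 a34 :
  moving_frame x y b l t a12 a13 a14 a23 a24 a34 ->
  moving_frame x' y' b' l' t a12 a13 a14 a23 a24 a34 ->
  is_derive (fun s => frame_dist2 (x s) (y s) (b s) (l s) (x' s) (y' s) (b' s) (l' s)) t 0.
Proof.
intros [Hx [Hy [Hb Hl]]] [Hx' [Hy' [Hb' Hl']]].
pose proof (is_derive4_sub _ _ _ _ _ Hx Hx') as Dx.
pose proof (is_derive4_sub _ _ _ _ _ Hy Hy') as Dy.
pose proof (is_derive4_sub _ _ _ _ _ Hb Hb') as Db.
pose proof (is_derive4_sub _ _ _ _ _ Hl Hl') as Dl.
assert (Dp : forall f g df dg, is_derive f t df -> is_derive g t dg ->
  is_derive (fun s => f s + g s) t (df + dg)).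
{ intros f g df dg Hf Hg. apply (is_derive_plus f g); assumption. }
evar (e : R). replace 0 with e; subst e.
{ unfold frame_dist2. apply Dp; [apply Dp; [apply Dp|]|].
  - exact (is_derive_vdot _ _ _ _ _ Dx Dx).
  - exact (is_derive_vdot _ _ _ _ _ Dy Dy).
  - exact (is_derive_vdot _ _ _ _ _ Db Db).
  - exact (is_derive_vdot _ _ _ _ _ Dl Dl). }
cbv beta. unfold vdot. simpl. ring.
Qed.

(** Position and frame are the five unknowns of a single system, one copy of it for each coordinate
    of the ambient space. *)
Inductive index := iz | ix | iy | ib | il.

Definition indices : list index := iz :: ix :: iy :: ib :: il :: nil.

Lemma in_indices i : In i indices.
Proof. destruct i; simpl; tauto. Qed.

(** Row [iz] expresses the velocity through [x] and [y], column [iz] vanishes because no equation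
    involves the position itself, and the remaining 4 by 4 block is skew. The same shape serves both
    directions. *)
Definition frame_coef (ex ey a12 a13 a14 a23 a24 a34 : R -> R -> R) (i j : index) : R -> R -> R :=
  match i, j with
  | iz, ix => ex | iz, iy => ey
  | ix, iy => a12 | ix, ib => a13 | ix, il => a14
  | iy, ix => fun u v => - a12 u v | iy, ib => a23 | iy, il => a24
  | ib, ix => fun u v => - a13 u v | ib, iy => fun u v => - a23 u v | ib, il => a34
  | il, ix => fun u v => - a14 u v | il, iy => fun u v => - a24 u v
  | il, ib => fun u v => - a34 u v
  | _, _ => fun _ _ => 0
  end.

Lemma frame_coef_ck_on D (HD : open (as_set D)) k ex ey a12 a13 a14 a23 a24 a34 :
  ck_on k D ex -> ck_on k D ey -> ck_on k D a12 -> ck_on k D a13 -> ck_on k D a14 ->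
  ck_on k D a23 -> ck_on k D a24 -> ck_on k D a34 ->
  forall i j, ck_on k D (frame_coef ex ey a12 a13 a14 a23 a24 a34 i j).
Proof.
intros. destruct i, j; simpl;
  try assumption; try (apply ck_on_opp; assumption); apply ck_on_const; assumption.
Qed.

Lemma pu_frame_coef ex ey a12 a13 a14 a23 a24 a34 i j u v :
  pu (frame_coef ex ey a12 a13 a14 a23 a24 a34 i j) u v =
  frame_coef (pu ex) (pu ey) (pu a12) (pu a13) (pu a14) (pu a23) (pu a24) (pu a34) i j u v.
Proof.
destruct i, j; simpl; try reflexivity; unfold pu;
  solve [apply Derive_const | apply (Derive_opp (fun t => _ t v))].
Qed.

Lemma pv_frame_coef ex ey a12 a13 a14 a23 a24 a34 i j u v :
  pv (frame_coef ex ey a12 a13 a14 a23 a24 a34 i j) u v =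
  frame_coef (pv ex) (pv ey) (pv a12) (pv a13) (pv a14) (pv a23) (pv a24) (pv a34) i j u v.
Proof.
destruct i, j; simpl; try reflexivity; unfold pv;
  solve [apply Derive_const | apply (Derive_opp (fun t => _ u t))].
Qed.

(** * The frame system *)

Lemma pu_mult f g u v : ex_derive (fun x => f x v) u -> ex_derive (fun x => g x v) u ->
  pu (fun u v => f u v * g u v) u v = pu f u v * g u v + f u v * pu g u v.
Proof. intros Hf Hg. apply (Derive_mult (fun x => f x v) (fun x => g x v)); assumption. Qed.

Lemma pv_mult f g u v : ex_derive (f u) v -> ex_derive (g u) v ->
  pv (fun u v => f u v * g u v) u v = pv f u v * g u v + f u v * pv g u v.
Proof. intros Hf Hg. apply (Derive_mult (f u) (g u)); assumption. Qed.

Definition zero2 : R -> R -> R := fun _ _ => 0.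
Definition one2 : R -> R -> R := fun _ _ => 1.

(** The factor [sE] converts the unit-speed formulas for the derivative along [x] into formulas for
    the derivative in [u]; likewise [sG] in [coef_v]. *)
Definition coef_u (sE g1 n1 la mu be1 : R -> R -> R) (i j : index) (u v : R) : R :=
  sE u v * frame_coef one2 zero2 g1 n1 zero2 la mu be1 i j u v.

Definition coef_v (sG g2 n2 la mu be2 : R -> R -> R) (i j : index) (u v : R) : R :=
  sG u v * frame_coef zero2 one2 (fun u v => - g2 u v) la mu n2 zero2 be2 i j u v.

Section Surface.

Context (D : R -> R -> Prop) (HD : open (as_set D))
  (sE sG g1 g2 n1 n2 la mu be1 be2 : R -> R -> R)
  (HsE : forall k, ck_on k D sE) (HsG : forall k, ck_on k D sG)
  (Hg1 : forall k, ck_on k D g1) (Hg2 : forall k, ck_on k D g2)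
  (Hn1 : forall k, ck_on k D n1) (Hn2 : forall k, ck_on k D n2)
  (Hla : forall k, ck_on k D la) (Hmu : forall k, ck_on k D mu)
  (Hbe1 : forall k, ck_on k D be1) (Hbe2 : forall k, ck_on k D be2).

Let ck_zero2 k : ck_on k D zero2 := ck_on_const D HD k 0.
Let ck_one2 k : ck_on k D one2 := ck_on_const D HD k 1.

Lemma coef_u_ck_on i j k : ck_on k D (coef_u sE g1 n1 la mu be1 i j).
Proof.
apply (ck_on_mult D HD k sE); [apply HsE|]. apply frame_coef_ck_on; auto.
Qed.

Lemma coef_v_ck_on i j k : ck_on k D (coef_v sG g2 n2 la mu be2 i j).
Proof.
apply (ck_on_mult D HD k sG); [apply HsG|].
apply frame_coef_ck_on; auto. apply ck_on_opp; auto.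
Qed.

(** Each entry of the matrix identity is closed by one kind of hypothesis. Row [iz], the equality of
    mixed derivatives of the position, uses the equations for [pv sE] and [pu sG]. The entries
    pairing [x] with [y] use the Gauss equation, those pairing [x] or [y] with [b] the two Codazzi
    equations for [la], [n1], [n2], those pairing [b] with [l] the Ricci equation, and those pairing
    [x] or [y] with [l] the equations for [pu mu] and [pv mu]. *)
Lemma frame_system_flat (u v : R) : D u v -> sE u v <> 0 -> sG u v <> 0 ->
  pv sE u v = - g1 u v * sE u v * sG u v ->
  pu sG u v = - g2 u v * sE u v * sG u v ->
  n1 u v * n2 u v - (la u v ^ 2 + mu u v ^ 2)
    = / sE u v * pu g2 u v + / sG u v * pv g1 u v - (g1 u v ^ 2 + g2 u v ^ 2) ->
  2 * la u v * g2 u v + mu u v * be1 u v - (n1 u v - n2 u v) * g1 u v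
    = / sE u v * pu la u v - / sG u v * pv n1 u v ->
  2 * la u v * g1 u v + mu u v * be2 u v + (n1 u v - n2 u v) * g2 u v
    = - (/ sE u v * pu n2 u v) + / sG u v * pv la u v ->
  g1 u v * be1 u v - g2 u v * be2 u v + (n1 u v - n2 u v) * mu u v
    = - (/ sE u v * pu be2 u v) + / sG u v * pv be1 u v ->
  pu mu u v = sE u v * (2 * mu u v * g2 u v + n1 u v * be2 u v - la u v * be1 u v) ->
  pv mu u v = sG u v * (2 * mu u v * g1 u v - la u v * be2 u v + n2 u v * be1 u v) ->
  forall i (w : index -> R),
    isum indices (fun j => pv (coef_u sE g1 n1 la mu be1 i j) u v * w j) +
    isum indices (fun j => coef_u sE g1 n1 la mu be1 i j u v *
      isum indices (fun k => coef_v sG g2 n2 la mu be2 j k u v * w k)) =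
    isum indices (fun j => pu (coef_v sG g2 n2 la mu be2 i j) u v * w j) +
    isum indices (fun j => coef_v sG g2 n2 la mu be2 i j u v *
      isum indices (fun k => coef_u sE g1 n1 la mu be1 j k u v * w k)).
Proof.
intros Huv HE0 HG0 Ev Gu E1 E2 E3 E4 Emu Gmu i w.
rewrite (isum_ext indices (fun j => pv (coef_u sE g1 n1 la mu be1 i j) u v * w j)
  (fun j => (pv sE u v * frame_coef one2 zero2 g1 n1 zero2 la mu be1 i j u v +
     sE u v * frame_coef (pv one2) (pv zero2) (pv g1) (pv n1) (pv zero2) (pv la) (pv mu)
       (pv be1) i j u v) * w j)).
2:{ intros j. rewrite <- pv_frame_coef. f_equal. apply pv_mult.
  - apply (ck_on_ex_derive_v 0 D); auto.
  - apply (ck_on_ex_derive_v 0 D); [|exact Huv].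
    apply frame_coef_ck_on; auto. }
rewrite (isum_ext indices (fun j => pu (coef_v sG g2 n2 la mu be2 i j) u v * w j)
  (fun j => (pu sG u v *
       frame_coef zero2 one2 (fun u v => - g2 u v) la mu n2 zero2 be2 i j u v +
     sG u v * frame_coef (pu zero2) (pu one2) (pu (fun u v => - g2 u v)) (pu la) (pu mu) (pu n2)
       (pu zero2) (pu be2) i j u v) * w j)).
2:{ intros j. rewrite <- pu_frame_coef. f_equal. apply pu_mult.
  - apply (ck_on_ex_derive_u 0 D); auto.
  - apply (ck_on_ex_derive_u 0 D); [|exact Huv].
    apply frame_coef_ck_on; auto. apply ck_on_opp; auto. }
assert (P0 : pu zero2 u v = 0) by exact (Derive_const 0 u).
assert (P1 : pu one2 u v = 0) by exact (Derive_const 1 u).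
assert (Q0 : pv zero2 u v = 0) by exact (Derive_const 0 v).
assert (Q1 : pv one2 u v = 0) by exact (Derive_const 1 v).
assert (Pg2 : pu (fun u v => - g2 u v) u v = - pu g2 u v)
  by (apply (Derive_opp (fun x => g2 x v))).
(* The unknown derivatives are eliminated through the unit-speed ones [/ sE * pu _]
   and [/ sG * pv _], which makes the compatibility conditions linear. *)
set (xg2 := / sE u v * pu g2 u v) in *.
assert (Xg2 : pu g2 u v = sE u v * xg2) by (unfold xg2; field; exact HE0).
set (yg1 := / sG u v * pv g1 u v) in *.
assert (Yg1 : pv g1 u v = sG u v * yg1) by (unfold yg1; field; exact HG0).
set (xla := / sE u v * pu la u v) in *.
assert (Xla : pu la u v = sE u v * xla) by (unfold xla; field; exact HE0).
set (yn1 := / sG u v * pv n1 u v) in *.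
assert (Yn1 : pv n1 u v = sG u v * yn1) by (unfold yn1; field; exact HG0).
set (xn2 := / sE u v * pu n2 u v) in *.
assert (Xn2 : pu n2 u v = sE u v * xn2) by (unfold xn2; field; exact HE0).
set (yla := / sG u v * pv la u v) in *.
assert (Yla : pv la u v = sG u v * yla) by (unfold yla; field; exact HG0).
set (xbe2 := / sE u v * pu be2 u v) in *.
assert (Xbe2 : pu be2 u v = sE u v * xbe2) by (unfold xbe2; field; exact HE0).
set (ybe1 := / sG u v * pv be1 u v) in *.
assert (Ybe1 : pv be1 u v = sG u v * ybe1) by (unfold ybe1; field; exact HG0).
clearbody xg2 yg1 xla yn1 xn2 yla xbe2 ybe1.
unfold coef_u, coef_v.
destruct i; unfold indices, isum, frame_coef, fold_right;
  rewrite ?P0, ?P1, ?Q0, ?Q1, ?Pg2, ?Ev, ?Gu, ?Emu, ?Gmu, ?Xg2, ?Yg1, ?Xla, ?Yn1, ?Xn2,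
    ?Yla, ?Xbe2, ?Ybe1; unfold zero2, one2.
- ring.
- replace yg1 with (n1 u v * n2 u v - (la u v ^ 2 + mu u v ^ 2) - xg2
    + (g1 u v ^ 2 + g2 u v ^ 2)) by lra.
  replace yn1 with (xla - (2 * la u v * g2 u v + mu u v * be1 u v
    - (n1 u v - n2 u v) * g1 u v)) by lra.
  ring.
- replace yg1 with (n1 u v * n2 u v - (la u v ^ 2 + mu u v ^ 2) - xg2
    + (g1 u v ^ 2 + g2 u v ^ 2)) by lra.
  replace yla with (xn2 + (2 * la u v * g1 u v + mu u v * be2 u v
    + (n1 u v - n2 u v) * g2 u v)) by lra.
  ring.
- replace yn1 with (xla - (2 * la u v * g2 u v + mu u v * be1 u v
    - (n1 u v - n2 u v) * g1 u v)) by lra.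
  replace yla with (xn2 + (2 * la u v * g1 u v + mu u v * be2 u v
    + (n1 u v - n2 u v) * g2 u v)) by lra.
  replace ybe1 with (xbe2 + (g1 u v * be1 u v - g2 u v * be2 u v
    + (n1 u v - n2 u v) * mu u v)) by lra.
  ring.
- replace ybe1 with (xbe2 + (g1 u v * be1 u v - g2 u v * be2 u v
    + (n1 u v - n2 u v) * mu u v)) by lra.
  ring.
Qed.

End Surface.

(** The Frenet-type formulas as genuine derivatives in [u] and [v], without division by [sE] or
    [sG]. This form mediates between the linear system and [is_geometric_surface]. *)
Definition frame_field (sE sG g1 g2 n1 n2 la mu be1 be2 : R -> R -> R)
  (z x y b l : R -> R -> V4) (u v : R) : Prop :=
  is_derive4 (fun s => z s v) u (vscal (sE u v) (x u v)) /\
  is_derive4 (z u) v (vscal (sG u v) (y u v)) /\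
  moving_frame (fun s => x s v) (fun s => y s v) (fun s => b s v) (fun s => l s v) u
    (sE u v * g1 u v) (sE u v * n1 u v) 0
    (sE u v * la u v) (sE u v * mu u v) (sE u v * be1 u v) /\
  moving_frame (x u) (y u) (b u) (l u) v
    (- (sG u v * g2 u v)) (sG u v * la u v) (sG u v * mu u v)
    (sG u v * n2 u v) 0 (sG u v * be2 u v).

(** * Orthonormality and uniqueness of frame fields *)

Section FrameField.

Context (u0 v0 r : R) (Hr : 0 < r) (sE sG g1 g2 n1 n2 la mu be1 be2 : R -> R -> R).
Let FF := frame_field sE sG g1 g2 n1 n2 la mu be1 be2.

Lemma frame_field_orthonormal z x y b l :
  (forall u v, square u0 v0 r u v -> FF z x y b l u v) ->
  orthonormal4 (x u0 v0) (y u0 v0) (b u0 v0) (l u0 v0) ->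
  forall u v, square u0 v0 r u v -> orthonormal4 (x u v) (y u v) (b u v) (l u v).
Proof.
intros HF H0 u v Huv. apply gram_defect_0. apply gram_defect_0 in H0. rewrite <- H0.
apply (constant_on_square u0 v0 r
  (fun u v => gram_defect (x u v) (y u v) (b u v) (l u v))); [|exact Huv].
intros u' v' Huv'. destruct (HF u' v' Huv') as [_ [_ [Hu Hv]]].
split; eapply gram_defect_constant; eassumption.
Qed.

Lemma frame_field_unique z x y b l z' x' y' b' l' :
  (forall u v, square u0 v0 r u v -> FF z x y b l u v) ->
  (forall u v, square u0 v0 r u v -> FF z' x' y' b' l' u v) ->
  z u0 v0 = z' u0 v0 -> x u0 v0 = x' u0 v0 -> y u0 v0 = y' u0 v0 ->
  b u0 v0 = b' u0 v0 -> l u0 v0 = l' u0 v0 ->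
  forall u v, square u0 v0 r u v -> z u v = z' u v.
Proof.
intros HF HF' Ez Ex Ey Eb El.
assert (Hxy : forall u v, square u0 v0 r u v -> x u v = x' u v /\ y u v = y' u v).
{ intros u v Huv.
  assert (E : frame_dist2 (x u v) (y u v) (b u v) (l u v)
      (x' u v) (y' u v) (b' u v) (l' u v) = 0).
  { rewrite (constant_on_square u0 v0 r (fun u v =>
      frame_dist2 (x u v) (y u v) (b u v) (l u v) (x' u v) (y' u v) (b' u v) (l' u v)));
      [|clear u v Huv|exact Huv].
    - rewrite Ex, Ey, Eb, El. unfold frame_dist2, vdot. simpl. ring.
    - intros u v Huv. destruct (HF u v Huv) as [_ [_ [Hu Hv]]].
      destruct (HF' u v Huv) as [_ [_ [Hu' Hv']]].
      split; [exact (frame_dist2_constant _ _ _ _ _ _ _ _ _ _ _ _ _ _ _ Hu Hu')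
             |exact (frame_dist2_constant _ _ _ _ _ _ _ _ _ _ _ _ _ _ _ Hv Hv')]. }
  unfold frame_dist2 in E.
  pose proof (vdot_pos (vadd (x u v) (vscal (-1) (x' u v)))).
  pose proof (vdot_pos (vadd (y u v) (vscal (-1) (y' u v)))).
  pose proof (vdot_pos (vadd (b u v) (vscal (-1) (b' u v)))).
  pose proof (vdot_pos (vadd (l u v) (vscal (-1) (l' u v)))).
  split; apply vdot_sub_0; lra. }
(* With the tangent vectors identified, [z] and [z'] have equal partial derivatives, so their
   squared distance is constant. *)
intros u v Huv. apply vdot_sub_0.
rewrite (constant_on_square u0 v0 r (fun u v =>
  vdot (vadd (z u v) (vscal (-1) (z' u v))) (vadd (z u v) (vscal (-1) (z' u v)))));
  [|clear u v Huv|exact Huv].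
- rewrite Ez. unfold vdot. simpl. ring.
- intros u v Huv. destruct (Hxy u v Huv) as [Hx Hy].
  destruct (HF u v Huv) as [Hu [Hv _]]. destruct (HF' u v Huv) as [Hu' [Hv' _]].
  pose proof (is_derive4_sub _ _ _ _ _ Hu Hu') as Du.
  pose proof (is_derive4_sub _ _ _ _ _ Hv Hv') as Dv.
  split; evar (e : R); replace 0 with e; subst e.
  + exact (is_derive_vdot _ _ _ _ _ Du Du).
  + cbv beta. rewrite Hx. unfold vdot. simpl. ring.
  + exact (is_derive_vdot _ _ _ _ _ Dv Dv).
  + cbv beta. rewrite Hy. unfold vdot. simpl. ring.
Qed.

End FrameField.

(** * Equivalence of geometric surfaces and orthonormal frame fields *)

Section GeometricSurface.

Context (g1 g2 n1 n2 la mu be1 be2 : R -> R -> R) (D0 : R -> R -> Prop).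
Let sE := sqrtE g1 g2 n1 n2 la mu be1 be2.
Let sG := sqrtG g1 g2 n1 n2 la mu be1 be2.
Hypothesis Hpos : forall u v, D0 u v -> 0 < sE u v /\ 0 < sG u v.
Let FF := frame_field sE sG g1 g2 n1 n2 la mu be1 be2.

(** Smoothness turns the values of [Derive] into actual derivatives, and positivity of [sE] and [sG]
    lets the inverse factors be cleared. Uniqueness is applied to the result. *)
Lemma geometric_surface_frame_field z u0 v0 p0 x0 y0 b0 l0 :
  is_geometric_surface g1 g2 n1 n2 la mu be1 be2 D0 z u0 v0 p0 x0 y0 b0 l0 ->
  z u0 v0 = p0 /\ exists x y b l,
    x u0 v0 = x0 /\ y u0 v0 = y0 /\ b u0 v0 = b0 /\ l u0 v0 = l0 /\
    forall u v, D0 u v -> FF z x y b l u v.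
Proof.
intros [Sz [Ez [_ [x [y [b [l [Sx [Sy [Sb [Sl [Ex [Ey [Eb [El H]]]]]]]]]]]]]]].
split; [exact Ez|]. exists x, y, b, l. do 4 (split; [assumption|]).
intros u v Huv. fold sE sG in H.
destruct (H u v Huv) as
  [_ [Hx [Hy [_ [_ [_ [_ [xx [xy [yx [yy [xb [yb [xl yl]]]]]]]]]]]]]].
destruct (Hpos u v Huv) as [HE HG].
apply Rgt_not_eq in HE. apply Rgt_not_eq in HG.
symmetry in Hx, Hy.
apply (vscal_inv _ _ _ HE) in Hx, xx, xy, xb, xl.
apply (vscal_inv _ _ _ HG) in Hy, yx, yy, yb, yl.
assert (Du : forall w d, smooth4_on D0 w -> pu4 w u v = d -> is_derive4 (fun s => w s v) u d).
{ intros w d Sw <-. apply (smooth4_is_derive4 D0 w u v Sw Huv). }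
assert (Dv : forall w d, smooth4_on D0 w -> pv4 w u v = d -> is_derive4 (w u) v d).
{ intros w d Sw <-. apply (smooth4_is_derive4 D0 w u v Sw Huv). }
split; [apply Du; assumption | split; [apply Dv; assumption | split]];
  split; [|split; [|split]| |split; [|split]].
- apply Du; [assumption|]. rewrite xx. apply V4_eq; simpl; ring.
- apply Du; [assumption|]. rewrite xy. apply V4_eq; simpl; ring.
- apply Du; [assumption|]. rewrite xb. apply V4_eq; simpl; ring.
- apply Du; [assumption|]. rewrite xl. apply V4_eq; simpl; ring.
- apply Dv; [assumption|]. rewrite yx. apply V4_eq; simpl; ring.
- apply Dv; [assumption|]. rewrite yy. apply V4_eq; simpl; ring.
- apply Dv; [assumption|]. rewrite yb. apply V4_eq; simpl; ring.
- apply Dv; [assumption|]. rewrite yl. apply V4_eq; simpl; ring.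
Qed.

Lemma frame_field_geometric_surface z x y b l u0 v0 :
  smooth4_on D0 z -> smooth4_on D0 x -> smooth4_on D0 y -> smooth4_on D0 b ->
  smooth4_on D0 l ->
  (forall u v, D0 u v -> FF z x y b l u v) ->
  (forall u v, D0 u v -> orthonormal4 (x u v) (y u v) (b u v) (l u v)) ->
  is_geometric_surface g1 g2 n1 n2 la mu be1 be2 D0 z u0 v0 (z u0 v0)
    (x u0 v0) (y u0 v0) (b u0 v0) (l u0 v0).
Proof.
intros Sz Sx Sy Sb Sl HF Ho. unfold is_geometric_surface. fold sE sG.
assert (Hz : forall u v, D0 u v ->
  pu4 z u v = vscal (sE u v) (x u v) /\ pv4 z u v = vscal (sG u v) (y u v)).
{ intros u v Huv. destruct (HF u v Huv) as [Hzu [Hzv _]].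
  split; [apply pu4_is_derive4 | apply pv4_is_derive4]; assumption. }
split; [exact Sz | split; [reflexivity | split]].
- intros u v Huv. destruct (Hz u v Huv) as [-> ->].
  destruct (Ho u v Huv) as [Exx [Eyy [_ [_ [Exy _]]]]].
  rewrite !vdot_vscal_l, !vdot_vscal_r, Exx, Eyy, Exy. repeat split; ring.
- exists x, y, b, l. do 4 (split; [assumption|]). do 4 (split; [reflexivity|]).
  intros u v Huv. cbv zeta. destruct (Hz u v Huv) as [Ezu Ezv].
  destruct (Ho u v Huv) as [_ [_ [_ [_ [_ [Exb [Exl [Eyb [Eyl _]]]]]]]]].
  destruct (Hpos u v Huv) as [HE HG].
  apply Rgt_not_eq in HE. apply Rgt_not_eq in HG.
  destruct (HF u v Huv) as [_ [_ [[Fux [Fuy [Fub Ful]]] [Fvx [Fvy [Fvb Fvl]]]]]].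
  rewrite Ezu, Ezv, (pu4_is_derive4 x _ _ _ Fux), (pu4_is_derive4 y _ _ _ Fuy),
    (pu4_is_derive4 b _ _ _ Fub), (pu4_is_derive4 l _ _ _ Ful),
    (pv4_is_derive4 x _ _ _ Fvx), (pv4_is_derive4 y _ _ _ Fvy),
    (pv4_is_derive4 b _ _ _ Fvb), (pv4_is_derive4 l _ _ _ Fvl).
  rewrite !vdot_vscal_r, (vdot_comm (b u v)), (vdot_comm (b u v) (y u v)),
    (vdot_comm (l u v) (x u v)), (vdot_comm (l u v) (y u v)), Exb, Exl, Eyb, Eyl.
  split; [exact (Ho u v Huv)|].
  split; [apply V4_eq; simpl; field; exact HE|].
  split; [apply V4_eq; simpl; field; exact HG|].
  do 4 (split; [ring|]).
  repeat split; apply V4_eq; simpl; field; assumption.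
Qed.

End GeometricSurface.

(** * Local existence and uniqueness of the surface *)

Theorem theorem4p1
  (D : R -> R -> Prop) (g1 g2 n1 n2 la mu be1 be2 : R -> R -> R)
  (HD : plane_domain D)
  (Hsm : smooth_on D g1 /\ smooth_on D g2 /\ smooth_on D n1 /\ smooth_on D n2 /\
         smooth_on D la /\ smooth_on D mu /\ smooth_on D be1 /\ smooth_on D be2)
  (Hpos : forall u v, D u v ->
     0 < sqrtE g1 g2 n1 n2 la mu be1 be2 u v /\
     0 < sqrtG g1 g2 n1 n2 la mu be1 be2 u v)
  (Heq : forall u v, D u v ->
     let sE := sqrtE g1 g2 n1 n2 la mu be1 be2 in
     let sG := sqrtG g1 g2 n1 n2 la mu be1 be2 in
     - g1 u v * sE u v * sG u v = pv sE u v /\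
     - g2 u v * sE u v * sG u v = pu sG u v /\
     n1 u v * n2 u v - (la u v ^ 2 + mu u v ^ 2)
       = / sE u v * pu g2 u v + / sG u v * pv g1 u v - (g1 u v ^ 2 + g2 u v ^ 2) /\
     2 * la u v * g2 u v + mu u v * be1 u v - (n1 u v - n2 u v) * g1 u v
       = / sE u v * pu la u v - / sG u v * pv n1 u v /\
     2 * la u v * g1 u v + mu u v * be2 u v + (n1 u v - n2 u v) * g2 u v
       = - (/ sE u v * pu n2 u v) + / sG u v * pv la u v /\
     g1 u v * be1 u v - g2 u v * be2 u v + (n1 u v - n2 u v) * mu u v
       = - (/ sE u v * pu be2 u v) + / sG u v * pv be1 u v)
  (u0 v0 : R) (H0 : D u0 v0) (p0 x0 y0 b0 l0 : V4)
  (Hframe : orthonormal4 x0 y0 b0 l0) :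
  exists D0 : R -> R -> Prop,
    plane_domain D0 /\ (forall u v, D0 u v -> D u v) /\ D0 u0 v0 /\
    exists z : R -> R -> V4,
      is_geometric_surface g1 g2 n1 n2 la mu be1 be2 D0 z u0 v0 p0 x0 y0 b0 l0 /\
      forall z' : R -> R -> V4,
        is_geometric_surface g1 g2 n1 n2 la mu be1 be2 D0 z' u0 v0 p0 x0 y0 b0 l0 ->
        forall u v, D0 u v -> z' u v = z u v.
Proof.
destruct HD as [_ [HD _]].
destruct Hsm as [Sg1 [Sg2 [Sn1 [Sn2 [Sla [Smu [Sbe1 Sbe2]]]]]]].
pose proof (proj1 (smooth_on_ck D g1) Sg1) as Cg1.
pose proof (proj1 (smooth_on_ck D g2) Sg2) as Cg2.
pose proof (proj1 (smooth_on_ck D n1) Sn1) as Cn1.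
pose proof (proj1 (smooth_on_ck D n2) Sn2) as Cn2.
pose proof (proj1 (smooth_on_ck D la) Sla) as Cla.
pose proof (proj1 (smooth_on_ck D mu) Smu) as Cmu.
pose proof (proj1 (smooth_on_ck D be1) Sbe1) as Cbe1.
pose proof (proj1 (smooth_on_ck D be2) Sbe2) as Cbe2.
set (sE := sqrtE g1 g2 n1 n2 la mu be1 be2) in *.
set (sG := sqrtG g1 g2 n1 n2 la mu be1 be2) in *.
pose (dE := fun u v => 2 * mu u v * g2 u v + n1 u v * be2 u v - la u v * be1 u v).
pose (dG := fun u v => 2 * mu u v * g1 u v - la u v * be2 u v + n2 u v * be1 u v).
(* [/ 0 = 0], so positivity of the quotients forces nonzero denominators. *)
assert (Hd0 : forall a d, 0 < a / d -> d <> 0).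
{ intros a d Hq ->. unfold Rdiv in Hq. rewrite Rinv_0 in Hq. lra. }
assert (HdE : forall u v, D u v -> dE u v <> 0)
  by (intros u v Huv; exact (Hd0 _ _ (proj1 (Hpos u v Huv)))).
assert (HdG : forall u v, D u v -> dG u v <> 0)
  by (intros u v Huv; exact (Hd0 _ _ (proj2 (Hpos u v Huv)))).
assert (CdE : forall k, ck_on k D dE).
{ intros k. apply (ck_on_minus D HD k (fun u v => 2 * mu u v * g2 u v + n1 u v * be2 u v));
    [apply (ck_on_plus D HD k (fun u v => 2 * mu u v * g2 u v)) |];
    repeat (apply (ck_on_mult D HD)); auto; apply (ck_on_const D HD). }
assert (CdG : forall k, ck_on k D dG).
{ intros k. apply (ck_on_plus D HD k (fun u v => 2 * mu u v * g1 u v - la u v * be2 u v));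
    [apply (ck_on_minus D HD k (fun u v => 2 * mu u v * g1 u v)) |];
    repeat (apply (ck_on_mult D HD)); auto; apply (ck_on_const D HD). }
assert (CsE : forall k, ck_on k D sE).
{ intros k. apply (ck_on_mult D HD k (pu mu) (fun u v => / dE u v)).
  - apply ck_on_pu, Cmu.
  - apply ck_on_inv; auto. }
assert (CsG : forall k, ck_on k D sG).
{ intros k. apply (ck_on_mult D HD k (pv mu) (fun u v => / dG u v)).
  - apply ck_on_pv, Cmu.
  - apply ck_on_inv; auto. }
pose (M := coef_u sE g1 n1 la mu be1). pose (N := coef_v sG g2 n2 la mu be2).
destruct (linear_frobenius indices in_indices D HD M N) with (u0 := u0) (v0 := v0)
  as [r [Hr [Hsub Hsol]]]; [| | |exact H0|].
{ intros i j. apply coef_u_ck_on; auto. }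
{ intros i j. apply coef_v_ck_on; auto. }
{ intros i w u v Huv. destruct (Hpos u v Huv) as [HE HG].
  apply Rgt_not_eq in HE. apply Rgt_not_eq in HG.
  destruct (Heq u v Huv) as [Ev [Gu [E1 [E2 [E3 E4]]]]].
  apply (frame_system_flat D HD); auto.
  - unfold sE, sqrtE. fold (dE u v). field. auto.
  - unfold sG, sqrtG. fold (dG u v). field. auto. }
set (Q := square u0 v0 r) in *.
assert (HQ : open (as_set Q)) by (intros p Hp; apply square_open, Hp).
assert (Q0 : Q u0 v0) by (apply square_center, Hr).
(* The argument [c] is a coordinate of the ambient space; the system is solved once for each of the
   four. *)
pose (init := fun (c : V4 -> R) i =>
  match i with iz => c p0 | ix => c x0 | iy => c y0 | ib => c b0 | il => c l0 end).
destruct (Hsol (init c0)) as [W0 [I0 HW0]].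
destruct (Hsol (init Defs.c1)) as [W1 [I1 HW1]].
destruct (Hsol (init c2)) as [W2 [I2 HW2]].
destruct (Hsol (init c3)) as [W3 [I3 HW3]].
pose (w := fun i u v => mkV4 (W0 i u v) (W1 i u v) (W2 i u v) (W3 i u v)).
assert (Sw : forall i, smooth4_on Q (w i)).
{ assert (CM : forall i j k, ck_on k Q (M i j)).
  { intros i j k. apply (ck_on_subset k D Q _ Hsub). apply coef_u_ck_on; auto. }
  assert (CN : forall i j k, ck_on k Q (N i j)).
  { intros i j k. apply (ck_on_subset k D Q _ Hsub). apply coef_v_ck_on; auto. }
  intros i. split; [|split; [|split]].
  - exact (linear_system_smooth Q HQ indices M N W0 CM CN HW0 i).
  - exact (linear_system_smooth Q HQ indices M N W1 CM CN HW1 i).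
  - exact (linear_system_smooth Q HQ indices M N W2 CM CN HW2 i).
  - exact (linear_system_smooth Q HQ indices M N W3 CM CN HW3 i). }
assert (Dw : forall i u v, Q u v ->
  is_derive4 (fun s => w i s v) u
    (mkV4 (isum indices (fun j => M i j u v * W0 j u v))
          (isum indices (fun j => M i j u v * W1 j u v))
          (isum indices (fun j => M i j u v * W2 j u v))
          (isum indices (fun j => M i j u v * W3 j u v))) /\
  is_derive4 (w i u) v
    (mkV4 (isum indices (fun j => N i j u v * W0 j u v))
          (isum indices (fun j => N i j u v * W1 j u v))
          (isum indices (fun j => N i j u v * W2 j u v))
          (isum indices (fun j => N i j u v * W3 j u v)))).
{ intros i u v Huv.
  destruct (HW0 i u v Huv) as [_ [A0 B0]]. destruct (HW1 i u v Huv) as [_ [A1 B1]].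
  destruct (HW2 i u v Huv) as [_ [A2 B2]]. destruct (HW3 i u v Huv) as [_ [A3 B3]].
  split; split; [|split; [|split]| |split; [|split]]; assumption. }
assert (FF : forall u v, Q u v ->
  frame_field sE sG g1 g2 n1 n2 la mu be1 be2 (w iz) (w ix) (w iy) (w ib) (w il) u v).
{ intros u v Huv.
  assert (Du : forall i d, d = mkV4 (isum indices (fun j => M i j u v * W0 j u v))
          (isum indices (fun j => M i j u v * W1 j u v))
          (isum indices (fun j => M i j u v * W2 j u v))
          (isum indices (fun j => M i j u v * W3 j u v)) ->
          is_derive4 (fun s => w i s v) u d)
    by (intros i d ->; exact (proj1 (Dw i u v Huv))).
  assert (Dv : forall i d, d = mkV4 (isum indices (fun j => N i j u v * W0 j u v))
          (isum indices (fun j => N i j u v * W1 j u v))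
          (isum indices (fun j => N i j u v * W2 j u v))
          (isum indices (fun j => N i j u v * W3 j u v)) ->
          is_derive4 (w i u) v d)
    by (intros i d ->; exact (proj2 (Dw i u v Huv))).
  unfold M, N, coef_u, coef_v, zero2, one2 in Du, Dv.
  split; [apply Du | split; [apply Dv | split]].
  3,4: split; [|split; [|split]].
  3-6: apply Du.
  7-10: apply Dv.
  all: apply V4_eq; simpl; ring. }
assert (Ew : w iz u0 v0 = p0 /\ w ix u0 v0 = x0 /\ w iy u0 v0 = y0 /\
             w ib u0 v0 = b0 /\ w il u0 v0 = l0).
{ unfold w. rewrite !I0, !I1, !I2, !I3. simpl. repeat split; apply V4_eq; reflexivity. }
destruct Ew as [Ez [Ex [Ey [Eb El]]]].
assert (HposQ : forall u v, Q u v -> 0 < sE u v /\ 0 < sG u v) by auto.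
assert (Ho : forall u v, Q u v ->
  orthonormal4 (w ix u v) (w iy u v) (w ib u v) (w il u v)).
{ intros u v Huv. apply (frame_field_orthonormal u0 v0 r _ _ _ _ _ _ _ _ _ _ _ _ _ _ _ FF);
    [|exact Huv]. rewrite Ex, Ey, Eb, El. exact Hframe. }
exists Q. split; [apply square_plane_domain, Hr | split; [exact Hsub | split; [exact Q0|]]].
exists (w iz). split.
- rewrite <- Ez, <- Ex, <- Ey, <- Eb, <- El.
  apply frame_field_geometric_surface; auto.
(* A competing surface brings a frame field of its own. It has the same value at the centre and
   obeys the same system, so it may be compared with the constructed one. *)
- intros z' Hz' u v Huv.
  destruct (geometric_surface_frame_field _ _ _ _ _ _ _ _ Q HposQ _ _ _ _ _ _ _ _ Hz')
    as [Ez' [x' [y' [b' [l' [Ex' [Ey' [Eb' [El' FF']]]]]]]]].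
  refine (frame_field_unique u0 v0 r _ _ _ _ _ _ _ _ _ _ z' x' y' b' l' _ _ _ _ _
    FF' FF _ _ _ _ _ u v Huv); congruence.
Qed.
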